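(* Let $f:[0,1]\to[0,1]$ be a mixing piecewise expanding unimodal map with critical point $c$, let $c_n=f^n(c)$, and let $\rho$ be the density of its unique absolutely continuous invariant measure. For $0<\beta<1$ define $$\mathcal N_\beta=\{\bar x:\ d(c_n,\bar x)\le\beta^n\ \text{for infinitely many } n\}.$$ If $\beta\,(\max_x|f'(x)|)<1$ and $\bar x\in\mathcal N_\beta$, then $\rho$ is non-differentiable at $\bar x$.
   Context: A map $f:[0,1]\to[0,1]$ is a piecewise expanding unimodal map (PEUM) if there are a point $c$ (the critical point), a number $\varepsilon>0$ and a constant $\lambda>1$ such that $f(x)=f_1(x)$ for $x\le c$ and $f(x)=f_2(x)$ for $x\ge c$, where $f_1$ is a $C^2$ map defined on $[0,c+\varepsilon]$, $f_2$ is a $C^2$ map defined on $[c-\varepsilon,1]$, $f_1(c)=f_2(c)$, and $|Df_j(x)|\ge\lambda$ for all $x$ in the domain of $f_j$. Such a map has a unique absolutely continuous invariant probability measure; its density $\rho$ is a function of bounded variation on $[0,1]$. Here $d$ is the usual distance on $[0,1]$, and $\max_x|f'(x)|$ is the supremum of $|f'(x)|$ over $x\ne c$, where $f'$ is defined. *)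

(* Defs.v *)
From HB Require Import structures.
From mathcomp Require Import all_boot all_order all_algebra.
From mathcomp Require Import all_classical all_reals all_analysis.
Import Order.TTheory GRing.Theory Num.Theory.
Import numFieldNormedType.Exports.

Set Implicit Arguments.
Unset Strict Implicit.
Unset Printing Implicit Defensive.

Local Open Scope classical_set_scope.
Local Open Scope ring_scope.

(* Maps of [0, 1] and functions on other intervals are total functions R -> R;
   nothing below depends on their values outside the relevant interval.
   Derivatives are therefore taken within a set: at an endpoint of an interval
   they are one-sided. *)
Section derivative_within.
Context {R : realType}.
Implicit Types (A : set R) (g : R -> R) (x : R).

Definition diff_quotient g x : R -> R := fun y => (g y - g x) / (y - x).

Definition derivable_within A g x : Prop :=
  cvg (diff_quotient g x @ within A x^').

Definition derive_within A g : R -> R :=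
  fun x => lim (diff_quotient g x @ within A x^').

Definition C2_on A g : Prop :=
  [/\ forall x, A x -> derivable_within A g x,
      forall x, A x -> derivable_within A (derive_within A g) x &
      {within A, continuous (derive_within A (derive_within A g))}].

End derivative_within.

Section unimodal_maps.
Context {R : realType}.
Implicit Types (f : R -> R) (c b : R).

Definition peum f c : Prop :=
  [/\ forall x, x \in `[0, 1] -> f x \in `[0, 1],
      c \in `[0, 1] &
      exists (e lam : R) (f1 f2 : R -> R),
        [/\ 0 < e /\ 1 < lam,
            (forall x, x \in `[0, 1] -> x <= c -> f x = f1 x) /\
            (forall x, x \in `[0, 1] -> c <= x -> f x = f2 x),
            f1 c = f2 c,
            C2_on `[0, c + e]%classic f1 /\
            (forall x, x \in `[0, c + e] ->
               lam <= `|derive_within `[0, c + e]%classic f1 x|) &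
            C2_on `[c - e, 1]%classic f2 /\
            (forall x, x \in `[c - e, 1] ->
               lam <= `|derive_within `[c - e, 1]%classic f2 x|)]].

(* The supremum over [0, 1] minus {c} of |f'|; at 0 and 1 the derivative is
   one-sided. *)
Definition max_abs_derive f c : R :=
  sup [set `|derive_within `[0, 1]%classic f x| | x in `[0, 1]%classic `\ c].

Definition Nbeta f c b : set R :=
  [set x | x \in `[0, 1] /\
           infinite_set [set n : nat | `|iter n f c - x| <= b ^+ n]].

End unimodal_maps.

(* A probability measure on [0, 1] is a probability measure on R that gives
   full mass to [0, 1]. *)
Section invariant_measures.
Context {R : realType}.
Implicit Types (f rho : R -> R) (mu : probability (measurableTypeR R) R).

Definition acip f mu : Prop :=
  [/\ mu `[0, 1]%classic = 1%E,
      mu `<< (@lebesgue_measure R) &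
      forall A : set (measurableTypeR R), measurable A -> A `<=` `[0, 1]%classic ->
        mu (`[0, 1]%classic `&` f @^-1` A) = mu A].

Definition mixing f mu : Prop :=
  forall A B : set (measurableTypeR R), measurable A -> measurable B ->
    A `<=` `[0, 1]%classic -> B `<=` `[0, 1]%classic ->
    (fun n => mu (`[0, 1]%classic `&` iter n f @^-1` A `&` B)) @ \oo
      --> (mu A * mu B)%E.

(* Densities are with respect to Lebesgue measure on R, with the version of
   bounded variation on [0, 1] that vanishes outside [0, 1]. This convention
   matters for differentiability at 0 and 1: the full tent map has density
   equal to 1 on [0, 1], which is constant there but jumps at the post-critical
   points 0 and 1. *)
Definition bv_density mu rho : Prop :=
  [/\ measurable_fun setT (rho : measurableTypeR R -> R),
      (forall A : set (measurableTypeR R), measurable A ->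
         mu A = (\int[@lebesgue_measure R]_(x in A) (rho x)%:E)%E),
      bounded_variation 0 1 rho &
      forall x, x \notin `[0, 1] -> rho x = 0].

End invariant_measures.

(* Main.v *)
(* One-sided limits of rho are one-sided derivatives of the distribution function F
   of mu, so invariance of mu becomes, for the jumps J(x) = rho(x+) - rho(x-), the
   relation J(x) = sum of J(y) / f'(y) over f(y) = x, valid away from f(c) once rho
   is extended by 0 and each branch of f affinely beyond [0, 1]. As rho has bounded
   variation, the total jump over any finite set is bounded, and the relation
   contracts it by 1 / lambda off the postcritical orbit: jumps live on that orbit.
   Expansion spreads an interval of positive density until it covers c, so
   J(c_1) <> 0, and then |J(c_n)| >= C / max|f'|^n. If rho were differentiable at
   xbar, then |J(c_n)| <= K |c_n - xbar| <= K beta^n for infinitely many n,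
   contradicting beta max|f'| < 1. *)
Require Import Defs.
From HB Require Import structures.
From mathcomp Require Import all_boot all_order all_algebra.
From mathcomp Require Import all_classical all_reals all_analysis.
From mathcomp Require Import ring lra.
Import Order.TTheory GRing.Theory Num.Theory.
Import numFieldNormedType.Exports.

Local Open Scope classical_set_scope.
Local Open Scope ring_scope.

Set Implicit Arguments.
Unset Strict Implicit.

(** Invariance compares measures of sets, while the values of [rho] are determined by [mu] only
    almost everywhere. This is why everything passes through [F], whose one-sided derivatives exist
    at every point: the jump relation is the right derivative minus the left derivative of one exact
    functional equation for [F]. The delicate point is the lower bound along the critical orbit. If
    the orbit is infinite, the second preimage of each later orbit point is off the orbit and
    carries no jump, so nothing can cancel. If it is eventually periodic, two orbit points may share
    an image and their contributions could cancel; following a vanishing jump around the cycle shows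
    that they do not. A map with a minimum at [c] is reduced to one with a maximum by the reflection
    of the line in the origin. *)

Section quotients.
Context {R : realType}.
Implicit Types (f g F : R -> R) (x y : R).

(** * Difference quotients along filters *)

Lemma diff_quotientC g x y : diff_quotient g x y = (g x - g y) / (x - y).
Proof.
by rewrite /diff_quotient -opprB -(opprB x y) mulNr invrN mulrN opprK.
Qed.

Lemma cvg_to_at_right (S : set_system R) g y : Filter S ->
  g z @[z --> S] --> y -> (\forall z \near S, y < g z) -> g z @[z --> S] --> y^'+.
Proof.
move=> FS gy gt A; rewrite /at_right /within /= => yA.
have gA : \forall z \near S, y < g z -> A (g z) := gy _ yA.
by apply: filterS2 gt gA => z ygz; exact.
Qed.

Lemma cvg_to_at_left (S : set_system R) g y : Filter S ->
  g z @[z --> S] --> y -> (\forall z \near S, g z < y) -> g z @[z --> S] --> y^'-.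
Proof.
move=> FS gy gt A; rewrite /at_left /within /= => yA.
have gA : \forall z \near S, g z < y -> A (g z) := gy _ yA.
by apply: filterS2 gt gA => z ygz; exact.
Qed.

(** The chain rule for a function that is, up to a constant, [F] at one inverse branch of [f] minus
    [F] at another. The filters are independent because an increasing inverse branch keeps the side
    of approach and a decreasing one reverses it. *)
Lemma diff_quotient_comp2 F f (S S1 S2 : set_system R) (g1 g2 : R -> R)
    x y1 y2 (r1 r2 d1 d2 : R) {FS : ProperFilter S} {FS1 : Filter S1}
    {FS2 : Filter S2} :
  g1 z @[z --> S] --> S1 -> g2 z @[z --> S] --> S2 ->
  diff_quotient F y1 z @[z --> S1] --> r1 ->
  diff_quotient F y2 z @[z --> S2] --> r2 ->
  diff_quotient f y1 z @[z --> S1] --> d1 ->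
  diff_quotient f y2 z @[z --> S2] --> d2 -> d1 != 0 -> d2 != 0 ->
  (\forall z \near S, [/\ g1 z != y1, g2 z != y2,
     f (g1 z) - f y1 = z - x, f (g2 z) - f y2 = z - x &
     F z - F x = F (g1 z) - F y1 - (F (g2 z) - F y2)]) ->
  diff_quotient F x z @[z --> S] --> r1 / d1 - r2 / d2.
Proof.
move=> g1S g2S r1S r2S d1S d2S d1n d2n nS.
have q1 : (diff_quotient F y1 (g1 z) / diff_quotient f y1 (g1 z)
           - diff_quotient F y2 (g2 z) / diff_quotient f y2 (g2 z))
          @[z --> S] --> r1 / d1 - r2 / d2.
  apply: cvgB; apply: cvgM; last 1 first.
  - by apply: cvgV => //; exact: (cvg_comp _ _ g2S d2S).
  - exact: (cvg_comp _ _ g1S r1S).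
  - by apply: cvgV => //; exact: (cvg_comp _ _ g1S d1S).
  - exact: (cvg_comp _ _ g2S r2S).
apply: cvg_trans q1; apply: near_eq_cvg.
apply: filterS nS => z [n1 n2 e1 e2 eF].
have aux (a b d : R) : b != 0 -> (a / b) / (d / b) = a / d.
  by move=> b0; rewrite invf_div mulrA divfK.
rewrite /diff_quotient e1 e2 eF.
rewrite aux ?subr_eq0// aux ?subr_eq0//.
by rewrite -mulrBl.
Qed.

End quotients.

(* [F] is the distribution function of the invariant measure, [rp x] and [rm x]
   are the right and left limits of its density at [x]. *)
Record bv_cdf {R : realType} (F rp rm : R -> R) (V : R) : Prop := BvCdf {
  cdf_nd : forall x y, x <= y -> F x <= F y;
  cdf_supp : exists l u, (forall x, x <= l -> F x = 0) /\
              (forall x, u <= x -> F x = 1);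
  cdf_rp : forall x, diff_quotient F x z @[z --> x^'+] --> rp x;
  cdf_rm : forall x, diff_quotient F x z @[z --> x^'-] --> rm x;
  cdf_jump : forall s : seq R, uniq s -> \sum_(x <- s) `|rp x - rm x| <= V;
  cdf_pos : exists a b al, [/\ a < b, 0 < al & forall u v, a <= u -> u < v ->
    v <= b -> al * (v - u) <= F v - F u]
}.

(** Here [f] lives on the whole line, so every point below [f c] has exactly two preimages and
    endpoints need no separate cases. The measure survives only in [ucdf_eq], which is invariance
    tested on the half-line up to [f y1], and in [ucdf_top]: there is no mass above the critical
    value. *)
Record unimodal_cdf {R : realType} (F f D rp rm : R -> R) (c lam M V : R) : Prop :=
  UnimodalCdf {
    ucdf_lam1 : 1 < lam;
    ucdf_inc : forall y z, y < z -> z <= c ->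
      lam * (z - y) <= f z - f y <= M * (z - y);
    ucdf_dec : forall y z, c <= y -> y < z ->
      lam * (z - y) <= f y - f z <= M * (z - y);
    ucdf_surjl : forall x, x < f c -> exists2 y, y < c & f y = x;
    ucdf_surjr : forall x, x < f c -> exists2 y, c < y & f y = x;
    ucdf_der : forall y, y != c -> diff_quotient f y z @[z --> y^'] --> D y;
    ucdf_eq : forall y1 y2, y1 < c -> c < y2 -> f y1 = f y2 ->
      F (f y1) = F y1 + 1 - F y2;
    ucdf_top : forall x, f c <= x -> F x = 1;
    ucdf_cdf :> bv_cdf F rp rm V
  }.

(** * The transfer relation for jumps *)

Section unimodal_cdf_theory.
Context {R : realType} {F f D rp rm : R -> R} {c lam M V : R}.
Hypothesis h : unimodal_cdf F f D rp rm c lam M V.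

Lemma ucdf_lam_gt0 : 0 < lam.
Proof. exact: lt_trans ltr01 (ucdf_lam1 h). Qed.

Lemma ucdf_lamM : lam <= M.
Proof.
have c1 : c - 1 < c by lra.
by have /andP[] := ucdf_inc h c1 (lexx c); lra.
Qed.

Let lam0 := ucdf_lam_gt0.

Local Notation jump x := (rp x - rm x).

Let der_left y : y != c -> diff_quotient f y z @[z --> y^'-] --> D y.
Proof. by move=> yc; apply: cvg_dnbhs_at_left; exact: (ucdf_der h). Qed.

Let der_right y : y != c -> diff_quotient f y z @[z --> y^'+] --> D y.
Proof. by move=> yc; apply: cvg_dnbhs_at_right; exact: (ucdf_der h). Qed.

Lemma ucdf_derl y : y < c -> lam <= D y <= M.
Proof.
move=> yc; have der := @der_left y (negbT (lt_eqF yc)).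
rewrite -(cvg_lim _ der)//; apply/andP; split.
  apply: limr_ge; first by apply/cvg_ex; exists (D y).
  near=> z; have zy : z < y by near: z; exact: nbhs_left_lt.
  have /andP[b1 b2] := ucdf_inc h zy (ltW yc).
  by rewrite diff_quotientC ler_pdivlMr ?subr_gt0.
apply: limr_le; first by apply/cvg_ex; exists (D y).
near=> z; have zy : z < y by near: z; exact: nbhs_left_lt.
have /andP[b1 b2] := ucdf_inc h zy (ltW yc).
by rewrite diff_quotientC ler_pdivrMr ?subr_gt0.
Unshelve. all: by end_near. Qed.

Lemma ucdf_derr y : c < y -> lam <= - D y <= M.
Proof.
move=> yc; have /cvgN der := @der_right y (negbT (gt_eqF yc)).
rewrite -(cvg_lim _ der)//; apply/andP; split.
  apply: limr_ge; first by apply/cvg_ex; exists (- D y).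
  near=> z; have zy : y < z by near: z; exact: nbhs_right_gt.
  have /andP[b1 b2] := ucdf_dec h (ltW yc) zy.
  by rewrite /= /diff_quotient -mulNr opprB ler_pdivlMr ?subr_gt0.
apply: limr_le; first by apply/cvg_ex; exists (- D y).
near=> z; have zy : y < z by near: z; exact: nbhs_right_gt.
have /andP[b1 b2] := ucdf_dec h (ltW yc) zy.
by rewrite /= /diff_quotient -mulNr opprB ler_pdivrMr ?subr_gt0.
Unshelve. all: by end_near. Qed.

Lemma ucdf_der_bounds y : y != c -> lam <= `|D y| <= M.
Proof.
rewrite neq_lt => /orP[] yc.
  have /andP[] := ucdf_derl yc => a b.
  by rewrite ger0_norm ?a ?b// (le_trans (ltW lam0)).
have /andP[] := ucdf_derr yc => a b.
by rewrite ler0_norm ?a ?b// -oppr_ge0 (le_trans (ltW lam0)).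
Qed.

Lemma ucdf_der_neq0 y : y != c -> D y != 0.
Proof.
move=> /ucdf_der_bounds/andP[a _]; rewrite -normr_gt0.
exact: lt_le_trans a.
Qed.

Lemma ucdf_lt_top y : y != c -> f y < f c.
Proof.
rewrite neq_lt => /orP[] yc.
  have /andP[b1 _] := ucdf_inc h yc (lexx c).
  have : 0 < lam * (c - y) by rewrite mulr_gt0// subr_gt0.
  lra.
have /andP[b1 _] := ucdf_dec h (lexx c) yc.
have : 0 < lam * (y - c) by rewrite mulr_gt0// subr_gt0.
lra.
Qed.

Lemma ucdf_branches : exists g1 g2 : R -> R, forall z, z < f c ->
  [/\ g1 z < c, c < g2 z, f (g1 z) = z & f (g2 z) = z].
Proof.
have /choice[g1 g1P] : forall z, exists y, z < f c -> y < c /\ f y = z.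
  move=> z; have [zc|] := ltP z (f c); last by exists 0.
  by have [y] := ucdf_surjl h zc; exists y.
have /choice[g2 g2P] : forall z, exists y, z < f c -> c < y /\ f y = z.
  move=> z; have [zc|] := ltP z (f c); last by exists 0.
  by have [y] := ucdf_surjr h zc; exists y.
exists g1, g2 => z zc.
by have [? ?] := g1P _ zc; have [? ?] := g2P _ zc.
Qed.

Lemma ucdf_left_exp u v : u <= c -> v <= c -> f u < f v ->
  0 < v - u <= (f v - f u) / lam.
Proof.
move=> uc vc fuv; have [uv|vu|uv] := ltgtP u v.
- have /andP[b1 _] := ucdf_inc h uv vc.
  by rewrite subr_gt0 uv/= ler_pdivlMr// mulrC.
- have /andP[b1 _] := ucdf_inc h vu uc.
  have : 0 < lam * (u - v) by rewrite mulr_gt0// subr_gt0.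
  lra.
- by move: fuv; rewrite uv ltxx.
Qed.

Lemma ucdf_right_exp u v : c <= u -> c <= v -> f v < f u ->
  0 < v - u <= (f u - f v) / lam.
Proof.
move=> uc vc fuv; have [uv|vu|uv] := ltgtP u v.
- have /andP[b1 _] := ucdf_dec h uc uv.
  by rewrite subr_gt0 uv/= ler_pdivlMr// mulrC.
- have /andP[b1 _] := ucdf_dec h vc vu.
  have : 0 < lam * (u - v) by rewrite mulr_gt0// subr_gt0.
  lra.
- by move: fuv; rewrite uv ltxx.
Qed.

(** Inverse branches of an expanding map contract by [1 / lam]; this gives their limits at a point
    directly. *)
Let cvg_expanding (S : set_system R) (g : R -> R) x y : Filter S ->
  z @[z --> S] --> x -> (\forall z \near S, `|g z - y| <= `|z - x| / lam) ->
  g z @[z --> S] --> y.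
Proof.
move=> FS Sx nS; apply/cvgrPdist_le => e e0.
have := Sx; move=> /cvgrPdist_le/(_ (e * lam) (mulr_gt0 e0 lam0)) nx.
apply: filterS2 nS nx => z; rewrite distrC => a b; rewrite (le_trans a)//.
by rewrite ler_pdivrMr// distrC.
Qed.

(** Differentiate [ucdf_eq] at [f y1] from each side. The left preimage approaches [y1] from the
    same side and the right one approaches [y2] from the opposite side, so [rp] at the image pairs
    with [rp y1] and [rm y2]. The swap at [y2] turns the minus sign of the functional equation into
    a plus for the jumps. *)
Lemma ucdf_transfer y1 y2 : y1 < c -> c < y2 -> f y1 = f y2 ->
  jump (f y1) = jump y1 / D y1 + jump y2 / D y2.
Proof.
move=> y1c cy2 fy; have [g1 [g2 gP]] := ucdf_branches.
have n1 : y1 != c by rewrite lt_eqF.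
have n2 : y2 != c by rewrite gt_eqF.
have ltc : f y1 < f c by exact: ucdf_lt_top.
have rpE : rp (f y1) = rp y1 / D y1 - rm y2 / D y2.
  have nc : \forall z \near (f y1)^'+, f y1 < z < f c.
    near=> z; apply/andP; split; near: z; [exact: nbhs_right_gt|exact: nbhs_right_lt].
  rewrite -(cvg_lim (@Rhausdorff R) (cdf_rp h (x := f y1))).
  apply: cvg_lim; first exact: Rhausdorff.
  have [q1 q2] : (\forall z \near (f y1)^'+, 0 < g1 z - y1 <= (z - f y1) / lam) /\
    (\forall z \near (f y1)^'+, 0 < y2 - g2 z <= (z - f y1) / lam).
    split; apply: filterS nc => z /andP[z1 z2]; have [g1c g2c f1 f2] := gP _ z2.
      have := @ucdf_left_exp y1 (g1 z) (ltW y1c) (ltW g1c).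
      by rewrite f1; exact.
    have := @ucdf_right_exp (g2 z) y2 (ltW g2c) (ltW cy2).
    by rewrite f2 -fy; exact.
  apply: (diff_quotient_comp2 (f := f) (g1 := g1) (g2 := g2) _ _
    (cdf_rp h (x := y1)) (cdf_rm h (x := y2))
    (der_right n1) (der_left n2) (ucdf_der_neq0 n1) (ucdf_der_neq0 n2)).
  - apply: cvg_to_at_right; last first.
    by apply: filterS q1 => z /andP[+ _]; rewrite subr_gt0.
    apply: (cvg_expanding (x := f y1)); first exact: cvg_at_right_filter.
    apply: filterS2 q1 nc => z /andP[a b] /andP[d _].
    by rewrite gtr0_norm// gtr0_norm// subr_gt0.
  - apply: cvg_to_at_left; last first.
    by apply: filterS q2 => z /andP[+ _]; rewrite subr_gt0.
    apply: (cvg_expanding (x := f y1)); first exact: cvg_at_right_filter.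
    apply: filterS2 q2 nc => z /andP[a b] /andP[d _].
    by rewrite distrC gtr0_norm// gtr0_norm// subr_gt0.
  - near=> z; have /andP[z1 z2] : f y1 < z < f c by near: z.
    have [g1c g2c f1 f2] := gP _ z2.
    have /andP[p1 _] : 0 < g1 z - y1 <= (z - f y1) / lam by near: z.
    have /andP[p2 _] : 0 < y2 - g2 z <= (z - f y1) / lam by near: z.
    split; rewrite ?f1 ?f2 ?fy//.
    + by rewrite gt_eqF// -subr_gt0.
    + by rewrite lt_eqF// -subr_gt0.
    + rewrite -fy (ucdf_eq h y1c cy2 fy) -{1}f1 (ucdf_eq h g1c g2c) ?f1//; lra.
have rmE : rm (f y1) = rm y1 / D y1 - rp y2 / D y2.
  have nc : \forall z \near (f y1)^'-, z < f y1.
    near=> z; near: z; exact: nbhs_left_lt.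
  rewrite -(cvg_lim (@Rhausdorff R) (cdf_rm h (x := f y1))).
  apply: cvg_lim; first exact: Rhausdorff.
  have [q1 q2] : (\forall z \near (f y1)^'-, 0 < y1 - g1 z <= (f y1 - z) / lam) /\
    (\forall z \near (f y1)^'-, 0 < g2 z - y2 <= (f y1 - z) / lam).
    split; apply: filterS nc => z z1; have [g1c g2c f1 f2] := gP _ (lt_trans z1 ltc).
      have := @ucdf_left_exp (g1 z) y1 (ltW g1c) (ltW y1c).
      by rewrite f1; exact.
    have := @ucdf_right_exp y2 (g2 z) (ltW cy2) (ltW g2c).
    by rewrite f2 -fy; exact.
  apply: (diff_quotient_comp2 (f := f) (g1 := g1) (g2 := g2) _ _
    (cdf_rm h (x := y1)) (cdf_rp h (x := y2))
    (der_left n1) (der_right n2) (ucdf_der_neq0 n1) (ucdf_der_neq0 n2)).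
  - apply: cvg_to_at_left; last first.
    by apply: filterS q1 => z /andP[+ _]; rewrite subr_gt0.
    apply: (cvg_expanding (x := f y1)); first exact: cvg_at_left_filter.
    apply: filterS2 q1 nc => z /andP[a b] d.
    by rewrite distrC gtr0_norm// distrC gtr0_norm// subr_gt0.
  - apply: cvg_to_at_right; last first.
    by apply: filterS q2 => z /andP[+ _]; rewrite subr_gt0.
    apply: (cvg_expanding (x := f y1)); first exact: cvg_at_left_filter.
    apply: filterS2 q2 nc => z /andP[a b] d.
    by rewrite gtr0_norm// distrC gtr0_norm// subr_gt0.
  - near=> z; have z1 : z < f y1 by near: z.
    have [g1c g2c f1 f2] := gP _ (lt_trans z1 ltc).
    have /andP[p1 _] : 0 < y1 - g1 z <= (f y1 - z) / lam by near: z.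
    have /andP[p2 _] : 0 < g2 z - y2 <= (f y1 - z) / lam by near: z.
    split; rewrite ?f1 ?f2 ?fy//.
    + by rewrite lt_eqF// -subr_gt0.
    + by rewrite gt_eqF// -subr_gt0.
    + rewrite -fy (ucdf_eq h y1c cy2 fy) -{1}f1 (ucdf_eq h g1c g2c) ?f1//; lra.
rewrite rpE rmE; lra.
Unshelve. all: by end_near. Qed.

End unimodal_cdf_theory.

(** * The jump at the critical value *)

Lemma geometric_small {R : realType} (q C e : R) : 0 <= q -> q < 1 -> 0 < e ->
  \forall n \near \oo, C * q ^+ n < e.
Proof.
move=> q0 q1 e0; have : C * q ^+ n @[n --> \oo] --> C * 0.
  by apply: cvgMr; apply: cvg_expr; rewrite ger0_norm.
rewrite mulr0 => /cvgrPdist_lt/(_ _ e0); apply: filterS => n.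
by rewrite sub0r normrN; apply: le_lt_trans; exact: ler_norm.
Qed.

Lemma finite_pos_lower_bound {R : realType} (a : nat -> R) n :
  (forall k, (k < n)%N -> 0 < a k) ->
  exists2 C, 0 < C & forall k, (k < n)%N -> C <= a k.
Proof.
elim: n => [|n IH] an; first by exists 1.
have [k kn|C C0 Ca] := IH; first by apply: an; exact: ltnW.
exists (Num.min C (a n)); first by rewrite lt_min C0 an.
move=> k; rewrite ltnS leq_eqVlt => /orP[/eqP->|kn].
  by rewrite ge_min lexx orbT.
by rewrite ge_min Ca.
Qed.

Section unimodal_cdf_jumps.
Context {R : realType} {F f D rp rm : R -> R} {c lam M V : R}.
Hypothesis h : unimodal_cdf F f D rp rm c lam M V.

Local Notation jump x := (rp x - rm x).

Let lam0 := ucdf_lam_gt0 h.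

Let M0 : 0 < M. Proof. exact: lt_le_trans (ucdf_lamM h). Qed.

Lemma ucdf_jump_above x : f c < x -> jump x = 0.
Proof.
move=> cx; have Fx : F x = 1 by apply: (ucdf_top h); exact: ltW.
have -> : rp x = 0.
  rewrite -(cvg_lim (@Rhausdorff R) (cdf_rp h (x := x))).
  apply: cvg_lim; first exact: Rhausdorff.
  apply: cvg_near_cst; near=> z.
  have xz : x < z by near: z; exact: nbhs_right_gt.
  by rewrite /diff_quotient Fx (ucdf_top h) ?subrr ?mul0r// ltW// (lt_trans cx).
have -> : rm x = 0.
  rewrite -(cvg_lim (@Rhausdorff R) (cdf_rm h (x := x))).
  apply: cvg_lim; first exact: Rhausdorff.
  apply: cvg_near_cst; near=> z.
  have xz : f c < z by near: z; exact: nbhs_left_gt.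
  by rewrite /diff_quotient Fx (ucdf_top h) ?subrr ?mul0r// ltW.
by rewrite subrr.
Unshelve. all: by end_near. Qed.

(** The mass of an interval below the critical value is the sum of the masses of its two preimages.
    Dropping one of them, by monotonicity of [F], gives the lower bounds used below. *)
Lemma ucdf_push u v : u < v -> v <= f c ->
  exists u1 v1 u2 v2, [/\ f u1 = u, f u2 = u, f v1 = v & f v2 = v] /\
    [/\ u1 < v1, v1 <= c, c <= v2, v2 < u2 &
        F v - F u = (F v1 - F u1) + (F u2 - F v2)].
Proof.
move=> uv vc; have uc : u < f c by exact: lt_le_trans vc.
have [u1 u1c fu1] := ucdf_surjl h uc; have [u2 cu2 fu2] := ucdf_surjr h uc.
(* For [v = f c] both preimages collapse to [c], out of reach of [ucdf_eq]; there [ucdf_top] gives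
   [F v = 1]. *)
have [v1 [v2 [fv1 fv2 v1c cv2 Fv]]] : exists v1 v2,
    [/\ f v1 = v, f v2 = v, v1 <= c, c <= v2 & F v = F v1 + 1 - F v2].
  move: vc; rewrite le_eqVlt => /orP[/eqP->|vc].
    by exists c, c; rewrite (ucdf_top h (lexx _)); split => //; lra.
  have [v1 v1c fv1] := ucdf_surjl h vc; have [v2 cv2 fv2] := ucdf_surjr h vc.
  exists v1, v2; split => //; [exact: ltW|exact: ltW|].
  by rewrite -{1}fv1 (ucdf_eq h v1c cv2) ?fv1.
exists u1, v1, u2, v2; split => //; split => //.
- have := @ucdf_left_exp _ _ _ _ _ _ _ _ _ _ h u1 v1 (ltW u1c) v1c.
  by rewrite fu1 fv1 => /(_ uv)/andP[]; rewrite subr_gt0.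
- have := @ucdf_right_exp _ _ _ _ _ _ _ _ _ _ h v2 u2 cv2 (ltW cu2).
  by rewrite fu2 fv2 => /(_ uv)/andP[]; rewrite subr_gt0.
- rewrite Fv -{1}fu1 (ucdf_eq h u1c cu2) ?fu1//; lra.
Qed.

Let slope a b al := forall u v, a <= u -> u < v -> v <= b ->
  al * (v - u) <= F v - F u.

(* An interval on which the density is bounded below is expanded by [f] until it
   contains the critical point. *)
Lemma ucdf_pos_crit : exists a b al, [/\ a < c, c < b, 0 < al & slope a b al].
Proof.
apply: contrapT => nex.
have [a0 [b0 [al0 [ab0 al0_gt0 sl0]]]] := cdf_pos h.
(* An interval with positive slope that does not have [c] inside lies in one branch. Its image is at
   least [lam] times longer, and the slope of [F] is divided by at most [M]. *)
have grow n : exists a b al, [/\ a < b, 0 < al, slope a b al &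
    lam ^+ n * (b0 - a0) <= b - a].
  elim: n => [|n [a [b [al [ab al_gt0 sl len]]]]].
    by exists a0, b0, al0; split => //; rewrite expr0 mul1r.
  have alM (x y : R) : al * x <= y -> 0 <= x -> forall w, w <= M * x ->
      al / M * w <= y.
    move=> xy x0 w wM; apply: le_trans xy.
    by rewrite mulrAC -mulrA ler_pM2l// ler_pdivrMr// mulrC.
  have next x y : lam * (b - a) <= y - x ->
      lam ^+ n.+1 * (b0 - a0) <= y - x.
    by apply: le_trans; rewrite exprS -mulrA ler_pM2l.
  have [bc|cb] := leP b c.
    have /andP[fab _] := ucdf_inc h ab bc.
    exists (f a), (f b), (al / M); split.
    - by rewrite -subr_gt0 (lt_le_trans _ fab)// mulr_gt0// subr_gt0.
    - by rewrite divr_gt0.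
    - move=> u v au uv vb.
      have bfc : f b <= f c.
        have [->//|/(ucdf_lt_top h)/ltW//] := eqVneq b c.
      have [u1 [v1 [u2 [v2 [[fu1 fu2 fv1 fv2] [uv1 v1c cv2 vu2 ->]]]]]] :=
        ucdf_push uv (le_trans vb bfc).
      have au1 : a <= u1.
        rewrite leNgt; apply/negP => u1a.
        have /andP[+ _] := ucdf_inc h u1a (ltW (lt_le_trans ab bc)).
        have : 0 < lam * (a - u1) by rewrite mulr_gt0// subr_gt0.
        move: au; rewrite -fu1; lra.
      have vb1 : v1 <= b.
        rewrite leNgt; apply/negP => bv1.
        have /andP[+ _] := ucdf_inc h bv1 v1c.
        have : 0 < lam * (v1 - b) by rewrite mulr_gt0// subr_gt0.
        move: vb; rewrite -fv1; lra.
      have /andP[_ fuv] := ucdf_inc h uv1 v1c.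
      rewrite fv1 fu1 in fuv.
      apply: (alM (v1 - u1)) => //; last by rewrite subr_ge0 ltW.
      have := sl _ _ au1 uv1 vb1; have := cdf_nd h (ltW vu2); lra.
    - exact: next.
  have [ca|ac] := leP c a; last by case: nex; exists a, b, al.
  have /andP[fab _] := ucdf_dec h ca ab.
  exists (f b), (f a), (al / M); split.
  - by rewrite -subr_gt0 (lt_le_trans _ fab)// mulr_gt0// subr_gt0.
  - by rewrite divr_gt0.
  - move=> u v bu uv va.
    have afc : f a <= f c.
      have [->//|/(ucdf_lt_top h)/ltW//] := eqVneq a c.
    have [u1 [v1 [u2 [v2 [[fu1 fu2 fv1 fv2] [uv1 v1c cv2 vu2 ->]]]]]] :=
      ucdf_push uv (le_trans va afc).
    have av2 : a <= v2.
      rewrite leNgt; apply/negP => v2a.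
      have /andP[+ _] := ucdf_dec h cv2 v2a.
      have : 0 < lam * (a - v2) by rewrite mulr_gt0// subr_gt0.
      move: va; rewrite -fv2; lra.
    have ub2 : u2 <= b.
      rewrite leNgt; apply/negP => bu2.
      have /andP[+ _] := ucdf_dec h (ltW cb) bu2.
      have : 0 < lam * (u2 - b) by rewrite mulr_gt0// subr_gt0.
      move: bu; rewrite -fu2; lra.
    have /andP[_ fuv] := ucdf_dec h cv2 vu2.
    rewrite fv2 fu2 in fuv.
    apply: (alM (u2 - v2)) => //; last by rewrite subr_ge0 ltW.
    have := sl _ _ av2 vu2 ub2; have := cdf_nd h (ltW uv1); lra.
  - exact: next.
have [l [u [Fl Fu]]] := cdf_supp h.
(* [F] is constant outside [[l, u]], so intervals of positive slope stay inside it; this bounds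
   their length and stops the growth. *)
have lenle a b al : a < b -> 0 < al -> slope a b al -> b - a <= u - l.
  move=> ab al_gt0 sl.
  suff : l <= a /\ b <= u by move=> [? ?]; lra.
  split; rewrite leNgt; apply/negP.
    move=> al_; have am : a < Num.min b l by rewrite lt_min ab.
    have := sl _ _ (lexx a) am; rewrite ge_min lexx => /(_ isT).
    rewrite !Fl ?subrr ?ge_min ?lexx ?orbT//; last exact: ltW.
    by rewrite leNgt mulr_gt0// subr_gt0.
  move=> ub; have am : Num.max a u < b by rewrite gt_max ab.
  have := sl (Num.max a u) _ _ am (lexx b); rewrite le_max lexx => /(_ isT).
  rewrite !Fu ?subrr ?le_max ?lexx ?orbT//; last exact: ltW.
  by rewrite leNgt mulr_gt0// subr_gt0.
have d0 : 0 < b0 - a0 by rewrite subr_gt0.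
have [||N _] := @geometric_small R lam^-1 (u - l) (b0 - a0) _ _ d0.
- by rewrite invr_ge0 ltW.
- by rewrite invf_lt1// (ucdf_lam1 h).
move=> /(_ N (leqnn N)); rewrite /= exprVn ltr_pdivrMr ?exprn_gt0//.
have [a [b [al [ab al_gt0 sl len]]]] := grow N.
rewrite mulrC ltNge => /negP; apply; apply: le_trans len _.
exact: lenle sl.
Qed.

(** [F] is constant to the right of [f c], so [rp] vanishes there. To the left, an interval
    [[z, f c]] has a left preimage ending at [c], of length at least [(f c - z) / M], on which [F]
    has slope at least [al]; hence the left limit is at least [al / M]. *)
Lemma ucdf_jump_top : jump (f c) != 0.
Proof.
have [a [b [al [ac cb al0 sl]]]] := ucdf_pos_crit.
have Fc := ucdf_top h (lexx (f c)).
have -> : rp (f c) = 0.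
  rewrite -(cvg_lim (@Rhausdorff R) (cdf_rp h (x := f c))).
  apply: cvg_lim; first exact: Rhausdorff.
  apply: cvg_near_cst; near=> z.
  have xz : f c < z by near: z; exact: nbhs_right_gt.
  by rewrite /diff_quotient Fc (ucdf_top h) ?subrr ?mul0r// ltW.
rewrite sub0r oppr_eq0 gt_eqF// (lt_le_trans (divr_gt0 al0 M0))//.
rewrite -(cvg_lim (@Rhausdorff R) (cdf_rm h (x := f c))).
apply: limr_ge; first by apply/cvg_ex; exists (rm (f c)); exact: (cdf_rm h).
near=> z.
have zc : z < f c by near: z; exact: nbhs_left_lt.
have za : f a < z.
  near: z; apply: nbhs_left_gt; apply: (ucdf_lt_top h); by rewrite lt_eqF.
have [u1 [v1 [u2 [v2 [[fu1 fu2 fv1 fv2] [uv1 v1c cv2 vu2 eF]]]]]] :=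
  ucdf_push zc (lexx _).
have vc : v1 = c.
  by apply/eqP; apply: contraPT fv1 => /(ucdf_lt_top h); rewrite lt_neqAle => /andP[/eqP].
have au1 : a <= u1.
  have := @ucdf_left_exp _ _ _ _ _ _ _ _ _ _ h a u1 (ltW ac).
  rewrite fu1 => /(_ (ltW (lt_le_trans uv1 v1c)) za)/andP[+ _].
  by rewrite subr_gt0 => /ltW.
have uc : u1 < c by rewrite -vc.
have := sl _ _ au1 uc (ltW cb).
have /andP[_] := ucdf_inc h uc (lexx c).
rewrite fu1 => fzc slc.
rewrite diff_quotientC ler_pdivlMr ?subr_gt0// mulrAC ler_pdivrMr//.
have := cdf_nd h (ltW vu2); rewrite eF vc => Fvu.
apply: (@le_trans _ _ (al * (M * (c - u1)))); first by rewrite ler_pM2l.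
by rewrite mulrCA mulrC ler_pM2r//; lra.
Unshelve. all: by end_near. Qed.

End unimodal_cdf_jumps.

(** * Jumps along the postcritical orbit *)

Section unimodal_cdf_orbit.
Context {R : realType} {F f D rp rm : R -> R} {c lam M V : R}.
Hypothesis h : unimodal_cdf F f D rp rm c lam M V.

Local Notation jump x := (rp x - rm x).

Let lam0 := ucdf_lam_gt0 h.

Let x_ n := iter n.+1 f c.

(* The total jump over a finite set avoiding the postcritical orbit is at most
   [1 / lam] times the total jump over its preimage, which avoids it as well. *)
Lemma ucdf_jump_off_orbit x : (forall n, x <> iter n.+1 f c) -> jump x = 0.
Proof.
(* The base case is the uniform bound [V] of [cdf_jump]. Ranging over all finite lists lets the
   induction pass from a list to its preimages. *)
have contr n (s : seq R) : uniq s -> {in s, forall x n, x <> x_ n} ->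
    \sum_(x <- s) `|jump x| <= V * lam^-1 ^+ n.
  elim: n s => [|n IH] s us off.
    by rewrite expr0 mulr1; exact: (cdf_jump h).
  have [g1 [g2 gP]] := ucdf_branches h.
  pose t := [seq z <- s | z < f c].
  have tP z : z \in t -> z < f c by rewrite mem_filter => /andP[].
  have toff z : z \in t -> forall n, z <> x_ n.
    by rewrite mem_filter => /andP[_ /off].
  (* Points above [f c] carry no jump and [f c] itself is [x_ 0], so only points with two preimages
     contribute. *)
  have -> : \sum_(z <- s) `|jump z| = \sum_(z <- t) `|jump z|.
    rewrite /t big_filter (bigID (fun z => z < f c))/= [X in _ + X]big1_seq ?addr0//.
    move=> z /andP[zc zs]; rewrite (ucdf_jump_above h) ?normr0//.
    rewrite lt_neqAle leNgt zc andbT; apply/eqP => fcz.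
    by apply: (off _ zs 0%N); rewrite -fcz.
  pose w := map g1 t ++ map g2 t.
  have uw : uniq w.
    rewrite cat_uniq !map_inj_in_uniq ?filter_uniq//=; last 2 first.
    - move=> y z /tP/gP[_ _ _ e] /tP/gP[_ _ _ e'] g2yz.
      by rewrite -e -e' g2yz.
    - move=> y z /tP/gP[_ _ e _] /tP/gP[_ _ e' _] g1yz.
      by rewrite -e -e' g1yz.
    rewrite andbT; apply/hasPn => _ /mapP[z /tP/gP[_ cz _ _] ->].
    apply/negP => /mapP[y /tP/gP[yc _ _ _] e].
    by move: (lt_trans yc cz); rewrite e ltxx.
  have woff : {in w, forall x n, x <> x_ n}.
    move=> z; rewrite mem_cat => /orP[] /mapP[y yt ->] k e.
    + apply: (toff _ yt k.+1); rewrite /x_ iterS -/(x_ k) -e.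
      by have [_ _ ->] := gP _ (tP _ yt).
    + apply: (toff _ yt k.+1); rewrite /x_ iterS -/(x_ k) -e.
      by have [_ _ _ ->] := gP _ (tP _ yt).
  have := IH _ uw woff.
  rewrite big_cat/= !big_map -big_split/= => le.
  rewrite exprSr mulrA ler_pdivlMr// (le_trans _ le)// mulr_suml.
  rewrite big_seq [leRHS]big_seq; apply: ler_sum => z /tP/gP[y1 y2 f1 f2].
  have n1 : g1 z != c by rewrite lt_eqF.
  have n2 : g2 z != c by rewrite gt_eqF.
  have /andP[d1 _] := ucdf_der_bounds h n1.
  have /andP[d2 _] := ucdf_der_bounds h n2.
  have divle (a d : R) : lam <= `|d| -> `|a / d| * lam <= `|a|.
    move=> ld; rewrite normrM normfV mulrAC ler_pdivrMr ?(lt_le_trans _ ld)//.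
    by rewrite ler_wpM2l.
  rewrite -[in X in X <= _]f1 (ucdf_transfer h y1 y2) ?f1//.
  apply: le_trans (lerD (divle _ _ d1) (divle _ _ d2)).
  by rewrite -mulrDl ler_pM2r// ler_normD.
move=> off; apply/eqP; rewrite -normr_le0; apply/ler_addgt0Pl => e e0.
rewrite addr0.
have [||N _] := @geometric_small R lam^-1 V e _ _ e0.
- by rewrite invr_ge0 ltW.
- by rewrite invf_lt1// (ucdf_lam1 h).
move=> /(_ N (leqnn N)) /= VN; apply: le_trans (ltW VN).
have := contr N [:: x] isT; rewrite big_seq1; apply.
by move=> y; rewrite inE => /eqP->.
Qed.

(** Strict monotonicity of each branch forces two points with the same image onto opposite sides of
    [c]. Leaving their order free suits orbit points, whose position is unknown. *)
Lemma ucdf_transfer_pair y y' : y != y' -> f y = f y' ->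
  [/\ y != c, y' != c & jump (f y) = jump y / D y + jump y' / D y'].
Proof.
have half u v : u < v -> f u = f v ->
    [/\ u != c, v != c & jump (f u) = jump u / D u + jump v / D v].
  move=> uv fuv.
  have uc : u < c.
    rewrite ltNge; apply/negP => cu.
    have := ucdf_dec h cu uv; rewrite fuv subrr => /andP[+ _].
    by rewrite leNgt mulr_gt0// subr_gt0.
  have cv : c < v.
    rewrite ltNge; apply/negP => vc.
    have := ucdf_inc h uv vc; rewrite fuv subrr => /andP[+ _].
    by rewrite leNgt mulr_gt0// subr_gt0.
  by rewrite lt_eqF// gt_eqF//; split => //; exact: (ucdf_transfer h).
rewrite neq_lt => /orP[] yy' e; first exact: half.
by have [? ? E] := half _ _ yy' (esym e); split => //; rewrite e E addrC.
Qed.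

(** The other preimage of [f y] is off the postcritical orbit and so has no jump: the whole jump at
    [f y] is inherited from [y]. *)
Lemma ucdf_transfer_one y : y != c ->
  (forall y', y' != y -> f y' = f y -> forall n, y' <> iter n.+1 f c) ->
  jump (f y) = jump y / D y.
Proof.
move=> yc off.
have [y' y'y fy'] : exists2 y', y' != y & f y' = f y.
  have fyc := ucdf_lt_top h yc.
  have [y1 y1c f1] := ucdf_surjl h fyc; have [y2 cy2 f2] := ucdf_surjr h fyc.
  have [e|y1y] := eqVneq y1 y; last by exists y1.
  by exists y2 => //; rewrite -e gt_eqF// (lt_trans y1c).
have yy' : y != y' by rewrite eq_sym.
have [_ _ ->] := ucdf_transfer_pair yy' (esym fy').
by rewrite (ucdf_jump_off_orbit (off _ y'y fy')) mul0r addr0.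
Qed.

Let jump0 : jump (x_ 0) != 0. Proof. exact: (ucdf_jump_top h). Qed.

Let x_S n : x_ n.+1 = f (x_ n). Proof. by []. Qed.

(** Injectivity keeps the orbit away from [c], since [x_ n = c] would give [x_ n.+1 = x_ 0], and
    makes [x_ n] the only orbit point above [x_ n.+1]. Each step then divides the jump by at most
    [M]. *)
Let jump_inj_lower : injective x_ ->
  forall n, `|jump (x_ 0)| <= `|jump (x_ n)| * M ^+ n.
Proof.
move=> inj; elim=> [|n IH]; first by rewrite expr0 mulr1.
have nc : x_ n != c.
  apply/eqP => e; have : x_ n.+1 = x_ 0 by rewrite x_S e.
  by move=> /inj.
rewrite x_S (ucdf_transfer_one nc); last first.
  move=> y' + + k e; rewrite e -/(x_ k) => xkn; rewrite -!x_S => /inj[kn].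
  by rewrite kn eqxx in xkn.
have /andP[dl dM] := ucdf_der_bounds h nc.
have d0 : 0 < `|D (x_ n)| by exact: lt_le_trans dl.
rewrite normrM normfV mulrAC ler_pdivlMr// exprSr mulrA.
apply: le_trans (ler_wpM2r (ltW d0) IH) _.
by rewrite ler_wpM2l// mulr_ge0// exprn_ge0// (le_trans (ltW d0)).
Qed.

(** Let [j] be the first index with [x_ j = x_ i] for some [i < j]. Only [x_ i] can inherit from two
    orbit points, its predecessor and [x_ j.-1]; at the other indices below [j] a jump vanishes
    exactly when the preceding one does. If the jump at [x_ i] vanished, so would all those on the
    cycle, up to [x_ j.-1]; then [x_ i] would inherit only the nonzero jump of its predecessor, a
    contradiction. For [i = 0] the point is [f c], already treated. *)
Let jump_fin_neq0 : ~ injective x_ ->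
  exists2 j, forall k, exists2 l, (l < j)%N & x_ k = x_ l &
  forall k, jump (x_ k) != 0.
Proof.
move=> ninj.
have ex_j : exists j, [exists i : 'I_j, x_ i == x_ j].
  apply: contrapT => nex; apply: ninj => a b e.
  have aux i j : (i < j)%N -> x_ i <> x_ j.
    by move=> ij eij; apply: nex; exists j; apply/existsP; exists (Ordinal ij); apply/eqP.
  by have [/aux|/aux/(_ (esym e))|] := ltngtP a b.
have [j /existsP[[i ij] /eqP/= xij] jmin] := ex_minnP ex_j.
have inj a b : (a < j)%N -> (b < j)%N -> x_ a = x_ b -> a = b.
  have aux i' j' : (i' < j')%N -> (j' < j)%N -> x_ i' <> x_ j'.
    move=> ij' j'j e; have := jmin j'; rewrite leqNgt j'j => /(_ _)/negP; apply=> //.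
    by apply/existsP; exists (Ordinal ij'); apply/eqP.
  by move=> aj bj e; have [/aux/(_ bj)|/aux/(_ aj)/(_ (esym e))|] := ltngtP a b.
have red k : exists2 l, (l < j)%N & x_ k = x_ l.
  elim: k => [|k [l lj IH]]; first by exists 0%N => //; exact: leq_trans ij.
  move: lj; rewrite leq_eqVlt => /orP[/eqP lj|lj].
    by exists i => //; rewrite xij -lj !x_S IH.
  by exists l.+1 => //; rewrite !x_S IH.
exists j => //.
have step k : (k.+1 < j)%N -> k.+1 != i ->
    (jump (x_ k.+1) == 0) = (jump (x_ k) == 0).
  move=> kj ki; have kj' := ltnW kj.
  have nc : x_ k != c.
    apply/eqP => e; have : x_ k.+1 = x_ 0 by rewrite x_S e.
    by move=> /(inj _ _ kj (ltn_trans (ltn0Sn k) kj)).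
  rewrite x_S (ucdf_transfer_one nc); last first.
    move=> y' + + m e; rewrite e -/(x_ m).
    have [l lj ->] := red m => xlk; rewrite -!x_S.
    (* When [l.+1 = j], the common image is [x_ j = x_ i], which forces [k.+1 = i], the index
       excluded from [step]. *)
    move: lj; rewrite leq_eqVlt => /orP[/eqP lj|lj].
      rewrite lj -xij => /(inj _ _ ij kj) ik.
      by rewrite ik eqxx in ki.
    by move=> /(inj _ _ lj kj)[lk]; rewrite lk eqxx in xlk.
  by rewrite mulf_eq0 invr_eq0 (negbTE (ucdf_der_neq0 h nc)) orbF.
have low k : (k < i)%N -> jump (x_ k) != 0.
  elim: k => // k IH ki.
  by rewrite step ?IH ?(ltn_eqF ki)//; [exact: ltnW|exact: ltn_trans ij].
have high k : (i + k < j)%N -> (jump (x_ (i + k)) == 0) = (jump (x_ i) == 0).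
  elim: k => [|k IH]; first by rewrite addn0.
  rewrite addnS => ikj; rewrite step//; first by rewrite IH// ltnW.
  by rewrite gtn_eqF// ltnS leq_addr.
have ji : jump (x_ i) != 0.
  case: i => [|i'] in ij xij step low high *; first exact: jump0.
  apply/negP => ji0; have j0 : (0 < j)%N by exact: leq_trans ij.
  have jE : j = j.-1.+1 by rewrite prednK.
  have hj : jump (x_ j.-1) == 0.
    have := high (j.-1 - i'.+1)%N; rewrite subnKC; last by rewrite -ltnS -jE.
    by rewrite ji0 => ->//; rewrite [ltnRHS]jE.
  have ne : x_ i' != x_ j.-1.
    apply/eqP => /inj; rewrite (ltnW ij) [X in (_ < X)%N]jE ltnS leqnn.
    by move=> /(_ isT isT) e; move: ij; rewrite jE -e ltnn.
  have fe : f (x_ i') = f (x_ j.-1) by rewrite -!x_S xij [in LHS]jE.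
  have [nc nc' E] := ucdf_transfer_pair ne fe.
  have := low i' (leqnn _).
  move: ji0; rewrite x_S E (eqP hj) mul0r addr0 mulf_eq0 invr_eq0.
  by rewrite (negbTE (ucdf_der_neq0 h nc)) orbF => ->.
move=> k; have [l lj ->] := red k.
have [il|] := leqP i l; last exact: low.
by have := high (l - i)%N; rewrite subnKC// => ->.
Qed.

(* A postcritical jump cannot vanish even when the critical orbit is eventually
   periodic and several contributions pile up at the same point. *)
Lemma ucdf_jump_lower : exists2 C, 0 < C & forall n, C <= `|jump (iter n.+1 f c)| * M ^+ n.
Proof.
have M1 : 1 <= M by exact: le_trans (ltW (ucdf_lam1 h)) (ucdf_lamM h).
have [inj|/jump_fin_neq0[j red jn0]] := pselect (injective x_).
  by exists `|jump (x_ 0)|; [rewrite normr_gt0|exact: jump_inj_lower].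
have jpos k : (k < j)%N -> 0 < `|jump (x_ k)| by rewrite normr_gt0.
have [C C0 CP] := finite_pos_lower_bound jpos.
exists C => // n; have [l lj e] := red n.
rewrite -/(x_ n) e (le_trans (CP l lj))// ler_peMr// exprn_ege1//.
Qed.

Theorem ucdf_not_lipschitz (beta xbar K d : R) :
  0 < beta -> beta < 1 -> beta * M < 1 -> 0 < d ->
  infinite_set [set n | `|iter n f c - xbar| <= beta ^+ n] ->
  (forall p, `|p - xbar| < d -> `|jump p| <= K * `|p - xbar|) -> False.
Proof.
move=> b0 b1 bM d0 inf lip; have [C C0 CP] := ucdf_jump_lower.
have M0 : 0 < M by exact: lt_le_trans lam0 (ucdf_lamM h).
have [N1 _ N1P] : \forall n \near \oo, 1 * beta ^+ n < d.
  by apply: geometric_small => //; exact: ltW.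
(* The lower bound at [iter n.+1 f c] has [n] factors [M] against [n.+1] factors [beta]; the extra
   [beta] goes into the constant. [K] may have any sign, hence its absolute value. *)
have [N2 _ N2P] : \forall n \near \oo, (`|K| * beta) * (beta * M) ^+ n < C.
  by apply: geometric_small => //; rewrite mulr_ge0// ltW.
(* The successor excludes the index 0: the lower bound on jumps starts at [f c], not at [c]. *)
pose N := (maxn N1 N2).+1.
have [n nb nN] : exists2 n, `|iter n f c - xbar| <= beta ^+ n & (N <= n)%N.
  apply: contrapT => nex; apply: inf; apply: (sub_finite_set _ (finite_II N)).
  by move=> n nb /=; rewrite ltnNge; apply/negP => nN; apply: nex; exists n.
case: n nb nN => // n nb; rewrite ltnS geq_max => /andP[nN1 nN2].
have close : `|iter n.+1 f c - xbar| < d.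
  apply: le_lt_trans nb _; have := N1P n.+1; rewrite mul1r; apply => /=.
  exact: leq_trans nN1 _.
have := N2P n nN2; rewrite /= ltNge => /negP; apply.
apply: le_trans (CP n) _; rewrite exprMn mulrA ler_pM2r ?exprn_gt0//.
apply: le_trans (lip _ close) _; rewrite -mulrA -exprS.
apply: le_trans (ler_wpM2r (normr_ge0 _) (ler_norm K)) _.
by rewrite ler_wpM2l.
Qed.

End unimodal_cdf_orbit.

(** * One-sided limits of monotone functions and of functions of bounded variation *)

Section one_sided_limits.
Context {R : realType}.
Implicit Types (G : R -> R) (x y : R).

Lemma near_right_interval (P : R -> Prop) x : (\forall y \near x^'+, P y) ->
  \forall z \near x^'+, forall y, x < y -> y <= z -> P y.
Proof.
move=> /nbhs_ballP[e /= e0 eP]; apply/nbhs_ballP; exists e => //= z.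
rewrite /ball/= => zx xz y xy yz; apply: eP => //.
rewrite /ball/= ltr0_norm ?subr_lt0// in zx *; rewrite ltr0_norm ?subr_lt0//; lra.
Qed.

Lemma near_left_interval (P : R -> Prop) x : (\forall y \near x^'-, P y) ->
  \forall z \near x^'-, forall y, z <= y -> y < x -> P y.
Proof.
move=> /nbhs_ballP[e /= e0 eP]; apply/nbhs_ballP; exists e => //= z.
rewrite /ball/= => zx xz y xy yz; apply: eP => //.
rewrite /ball/= gtr0_norm ?subr_gt0// in zx *; rewrite gtr0_norm ?subr_gt0//; lra.
Qed.

(** Over an increasing list the jumps telescope, because the right limit at a point is at most the
    left limit at any later one. *)
Lemma nondecreasing_jumps G lo hi : {homo G : x y / x <= y} ->
    (forall x, lo <= G x <= hi) ->
  exists Gr Gl : R -> R, [/\ forall x, G y @[y --> x^'+] --> Gr x,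
    forall x, G y @[y --> x^'-] --> Gl x, forall x, Gl x <= Gr x &
    forall s : seq R, uniq s -> \sum_(x <- s) (Gr x - Gl x) <= hi - lo].
Proof.
move=> Gnd bnd.
have cvr x : cvg (G y @[y --> x^'+]).
  apply: nondecreasing_at_right_is_cvgr; near=> z.
    by move=> u v _ _; exact: Gnd.
  by exists lo => _ [u _ <-]; case/andP: (bnd u).
have cvl x : cvg (G y @[y --> x^'-]).
  apply: nondecreasing_at_left_is_cvgr; near=> z.
    by move=> u v _ _; exact: Gnd.
  by exists hi => _ [u _ <-]; case/andP: (bnd u).
pose Gr x := lim (G y @[y --> x^'+]); pose Gl x := lim (G y @[y --> x^'-]).
have GlG x y : x <= y -> Gl x <= G y.
  move=> xy; apply: limr_le; first exact: cvl.
  near=> z; apply: Gnd; apply: le_trans xy.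
  by apply: ltW; near: z; exact: nbhs_left_lt.
have GGr x y : y <= x -> G y <= Gr x.
  move=> xy; apply: limr_ge; first exact: cvr.
  near=> z; apply: Gnd; apply: le_trans xy _.
  by apply: ltW; near: z; exact: nbhs_right_gt.
have GrGl x y : x < y -> Gr x <= Gl y.
  move=> xy; pose m := (x + y) / 2.
  apply: (@le_trans _ _ (G m)).
    apply: limr_le; first exact: cvr.
    near=> z; apply: Gnd; near: z; apply: nbhs_right_le; rewrite /m; lra.
  apply: limr_ge; first exact: cvl.
  near=> z; apply: Gnd; near: z; apply: nbhs_left_ge; rewrite /m; lra.
have lesum (s : seq R) a : path <%R a s -> \sum_(x <- s) (Gr x - Gl x) <= hi - Gr a.
  elim: s a => [a _|b s IH a /= /andP[ab /IH les]].
    rewrite big_nil subr_ge0; apply: limr_le; first exact: cvr.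
    by near=> z; case/andP: (bnd z).
  by rewrite big_cons; have := GrGl _ _ ab; lra.
exists Gr, Gl; split => // [x|s us].
  exact: le_trans (GlG x x (lexx x)) (GGr x x (lexx x)).
have [s' ps' ss'] : exists2 s', perm_eq s s' & sorted <%R s'.
  exists (sort <=%R s); first by rewrite perm_sym perm_sort.
  by rewrite sort_lt_sorted.
rewrite (perm_big _ ps')/=; case: s' ps' ss' => [|a s'] _ ss'.
  by rewrite big_nil; have /andP[] := bnd 0; lra.
(* [lesum] needs a starting point strictly below the list; its right limit is at least [lo]. *)
have pa : path <%R (a - 1) (a :: s') by rewrite /= ltrBlDr ltrDl ltr01.
apply: le_trans (lesum _ _ pa) _; rewrite lerD2l lerN2.
by apply: le_trans (GGr _ _ (lexx (a - 1))); case/andP: (bnd (a - 1)).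
Unshelve. all: by end_near. Qed.

(** Jordan decomposition on [[0, 1]]. Both monotone parts are extended by the same constants, [lo]
    to the left and [hi] to the right, chosen so that monotonicity persists across 0 and 1; their
    difference is then 0 outside, as [rho] is. The bound [V] is twice [hi - lo], once for each
    part. *)
Lemma bv_zero_extension_jumps (rho : R -> R) :
    bounded_variation 0 1 rho -> (forall x, x \notin `[0, 1] -> rho x = 0) ->
  exists rp rm V, [/\ forall x, rho y @[y --> x^'+] --> rp x,
    forall x, rho y @[y --> x^'-] --> rm x, forall x, `|rho x| <= V &
    forall s : seq R, uniq s -> \sum_(x <- s) `|rp x - rm x| <= V].
Proof.
move=> bv rho0.
pose g : R -> R := fine \o pos_tv 0 rho; pose k : R -> R := fine \o neg_tv 0 rho.
have gnd : {in `[0, 1] &, {homo g : x y / x <= y}}.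
  by apply: fine_neg_tv_nondecreasing; exact: bounded_variationN.
have knd : {in `[0, 1] &, {homo k : x y / x <= y}} by exact: fine_neg_tv_nondecreasing.
pose lo := Num.min (g 0) (k 0); pose hi := Num.max (g 1) (k 1).
pose ext (q : R -> R) x := if x < 0 then lo else if x <= 1 then q x else hi.
have extP q : {in `[0, 1] &, {homo q : x y / x <= y}} -> lo <= q 0 -> q 1 <= hi ->
    {homo ext q : x y / x <= y} /\ (forall x, lo <= ext q x <= hi).
  move=> qnd q0 q1.
  have i01 x : x < 0 = false -> x <= 1 -> x \in `[0, 1].
    by move=> x0 x1; rewrite in_itv/= x1 leNgt x0.
  have m0 : (0 : R) \in `[0, 1] by rewrite in_itv/= lexx ler01.
  have m1 : (1 : R) \in `[0, 1] by rewrite in_itv/= lexx ler01.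
  have qbnd x : x \in `[0, 1] -> lo <= q x <= hi.
    move=> /[dup] xi; rewrite in_itv/= => /andP[x0 x1].
    by rewrite (le_trans q0 (qnd _ _ m0 xi x0)) (le_trans (qnd _ _ xi m1 x1) q1).
  have lohi : lo <= hi by have /andP[] := qbnd 0 m0; exact: le_trans.
  have bnd x : lo <= ext q x <= hi.
    rewrite /ext; case: ifPn => x0; first by rewrite lexx.
    case: ifPn => x1; last by rewrite lexx lohi.
    by apply: qbnd; exact: i01 (negbTE x0) x1.
  split => // x y xy; have [lx xh] := andP (bnd x); have [ly yh] := andP (bnd y).
  move: lx xh ly yh; rewrite /ext.
  case: (ltP x 0) => // x0; case: (ltP y 0) => y0; first by lra.
  case: (leP y 1) => y1; case: (leP x 1) => x1 //; last by lra.
  by move=> _ _ _ _; apply: qnd => //; rewrite in_itv/= ?x0 ?y0.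
have [Gnd Gb] := extP g gnd (ltac:(by rewrite /lo ge_min lexx))
  (ltac:(by rewrite /hi le_max lexx)).
have [Hnd Hb] := extP k knd (ltac:(by rewrite /lo ge_min lexx orbT))
  (ltac:(by rewrite /hi le_max lexx orbT)).
have rhoE : rho = fun x => ext g x - ext k x.
  apply/funext => x; rewrite /ext; case: ltP => x0.
    by rewrite subrr rho0// in_itv/= leNgt x0.
  case: leP => x1; last by rewrite subrr rho0// in_itv/= [x <= 1]leNgt x1 andbF.
  by rewrite (bounded_variation_pos_neg_tvE bv) ?in_itv/= ?x0.
have [Gr [Gl [Gcr Gcl GlGr Gsum]]] := nondecreasing_jumps Gnd Gb.
have [Hr [Hl [Hcr Hcl HlHr Hsum]]] := nondecreasing_jumps Hnd Hb.
exists (fun x => Gr x - Hr x), (fun x => Gl x - Hl x), ((hi - lo) + (hi - lo)).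
split=> [x|x|x|s us].
- by rewrite rhoE; exact: cvgB (Gcr x) (Hcr x).
- by rewrite rhoE; exact: cvgB (Gcl x) (Hcl x).
- rewrite rhoE ler_norml; have := Gb x; have := Hb x; lra.
- apply: le_trans (lerD (Gsum s us) (Hsum s us)); rewrite -big_split/=.
  apply: ler_sum => x _; have := GlGr x; have := HlHr x => a b.
  have -> : Gr x - Hr x - (Gl x - Hl x) = (Gr x - Gl x) - (Hr x - Hl x) by ring.
  by rewrite (le_trans (ler_normB _ _))// !ger0_norm ?subr_ge0.
Qed.

End one_sided_limits.

(** * One-sided derivatives of a function with given density *)

Section slopes.
Context {R : realType}.
Variables (F rho : R -> R).
(** All that is kept of the integral. The bounds on [rho] are asked strictly between [a] and [b], so
    its values at the endpoints do not matter; this is what makes one-sided limits sufficient. *)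
Hypothesis slope : forall a b al ga : R, a < b ->
  (forall y, a < y -> y < b -> al <= rho y <= ga) ->
  al * (b - a) <= F b - F a <= ga * (b - a).

Lemma diff_quotient_right (x l : R) : rho y @[y --> x^'+] --> l ->
  diff_quotient F x z @[z --> x^'+] --> l.
Proof.
move=> /cvgrPdist_le rl; apply/cvgrPdist_le => e e0.
have := near_right_interval (rl _ e0) => nx; near=> z.
have xz : x < z by near: z; exact: nbhs_right_gt.
have bnd y : x < y -> y < z -> l - e <= rho y <= l + e.
  move=> xy yz; have : `|l - rho y| <= e.
    have H : forall y, x < y -> y <= z -> `|l - rho y| <= e by near: z.
    by apply: H => //; exact: ltW.
  rewrite ler_norml; lra.
have /andP[s1 s2] := slope xz bnd.
rewrite /diff_quotient ler_distlC ler_pdivrMr ?ler_pdivlMr ?subr_gt0//.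
by rewrite s1 s2.
Unshelve. all: by end_near. Qed.

Lemma diff_quotient_left (x l : R) : rho y @[y --> x^'-] --> l ->
  diff_quotient F x z @[z --> x^'-] --> l.
Proof.
move=> /cvgrPdist_le rl; apply/cvgrPdist_le => e e0.
have := near_left_interval (rl _ e0) => nx; near=> z.
have xz : z < x by near: z; exact: nbhs_left_lt.
have bnd y : z < y -> y < x -> l - e <= rho y <= l + e.
  move=> xy yz; have : `|l - rho y| <= e.
    have H : forall y, z <= y -> y < x -> `|l - rho y| <= e by near: z.
    by apply: H => //; exact: ltW.
  rewrite ler_norml; lra.
have /andP[s1 s2] := slope xz bnd.
rewrite diff_quotientC ler_distlC ler_pdivrMr ?ler_pdivlMr ?subr_gt0//.
by rewrite s1 s2.
Unshelve. all: by end_near. Qed.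

(* With [q] half the mean slope of [F], the minimum of [F y - q * y] over the segment
   is not attained at [b], and where it is attained the right derivative of [F] is
   at least [q]. *)
Lemma slope_pos_interval (rp : R -> R) (a b : R) : a < b -> F a < F b ->
    {within `[a, b], continuous F} ->
    (forall x, rho y @[y --> x^'+] --> rp x) ->
  exists u v al, [/\ u < v, 0 < al & forall x y, u <= x -> x < y -> y <= v ->
    al * (y - x) <= F y - F x].
Proof.
move=> ab Fab Fc rrp; pose q := (F b - F a) / (b - a) / 2.
have q0 : 0 < q by rewrite !divr_gt0 ?subr_gt0.
have qab : q * (b - a) = (F b - F a) / 2.
  by rewrite /q mulrAC divfK// subr_eq0 gt_eqF.
pose phi y := F y - q * y.
have phic : {within `[a, b], continuous phi}.
  move=> x; apply: continuousB; first exact: Fc.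
  by apply: continuous_subspaceT => {}x; exact: mulrl_continuous.
have [x0 x0ab x0min] := EVT_min (ltW ab) phic.
have x0b : x0 < b.
  rewrite lt_neqAle (itvP x0ab) andbT; apply/eqP => x0E.
  have := x0min a; rewrite in_itv/= lexx (ltW ab) => /(_ isT).
  rewrite x0E /phi; lra.
have rpq : q <= rp x0.
  rewrite -(cvg_lim (@Rhausdorff R) (diff_quotient_right (rrp x0))).
  apply: limr_ge; first by apply/cvg_ex; exists (rp x0); exact: diff_quotient_right.
  near=> z; have xz : x0 < z by near: z; exact: nbhs_right_gt.
  have zb : z < b by near: z; exact: nbhs_right_lt.
  have := x0min z; rewrite in_itv/= (ltW zb) (le_trans _ (ltW xz)) ?(itvP x0ab)//.
  move=> /(_ isT); rewrite /phi /diff_quotient ler_pdivlMr ?subr_gt0//; lra.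
have /cvgrPdist_le/(_ (q / 2)) := rrp x0; rewrite divr_gt0// => /(_ isT).
move=> /near_right_interval nx.
have [v [xv vP]] : exists v, x0 < v /\
    forall y, x0 < y -> y <= v -> `|rp x0 - rho y| <= q / 2.
  near x0^'+ => v; exists v; split; first by near: v; exact: nbhs_right_gt.
  by near: v.
exists x0, v, (q / 2); split=> // [|x y ux xy yv]; first by rewrite divr_gt0.
have bnd z : x < z -> z < y -> q / 2 <= rho z <= rp x0 + q / 2.
  move=> xz zy; have := vP z (le_lt_trans ux xz) (le_trans (ltW zy) yv).
  rewrite ler_norml; lra.
by have /andP[] := slope xy bnd.
Unshelve. all: by end_near. Qed.

End slopes.

(** * The distribution function of the invariant measure *)

Section distribution_function.
Context {R : realType} (mu : probability (measurableTypeR R) R) (rho : R -> R).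
Hypothesis mu01 : mu `[0, 1]%classic = 1%E.
Hypothesis mu_ac : mu `<< (@lebesgue_measure R).

Definition distribution_fun (x : R) : R := fine (mu `]-oo, x]%classic).

Local Notation F := distribution_fun.
Local Notation mset := (set (measurableTypeR R)).

Let mi (i : interval R) : measurable ([set` i] : mset).
Proof. exact: measurable_itv. Qed.

Let FE x : mu `]-oo, x]%classic = (F x)%:E.
Proof. by rewrite fineK// fin_num_measure. Qed.

(** Absolute continuity excludes atoms, so endpoints of intervals can be added or dropped at
    will. *)
Let mu_pt x : mu [set x] = 0%E.
Proof.
have m1 : measurable ([set x] : mset) by exact: measurable_set1.
have null : (@lebesgue_measure R).-null_set ([set x] : mset).
  by apply/(measure0_null_setP _ m1); exact: lebesgue_measure_set1.
exact: mu_ac null _ m1 (@subset_refl _ _).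
Qed.

Let mu_oc a b : a <= b -> mu `]a, b]%classic = (F b - F a)%:E.
Proof.
move=> ab; have := FE b.
rewrite (@itv_bndbnd_setU _ _ -oo%O (BRight a) (BRight b))// measureU//; last first.
  by apply/seteqP; split => // x [] /=; rewrite !in_itv/= => xa /andP[]; lra.
move: (FE a) => /= ->; rewrite EFinB => <-.
by rewrite addeAC subee ?add0e.
Qed.

Let mu_oo a b : mu `]a, b[%classic = mu `]a, b]%classic.
Proof.
have [ab|ba] := ltP a b; last by rewrite !set_itv_ge// bnd_simp -leNgt.
rewrite -(@setUitv1 _ _ (BRight a) b true)// measureU//.
- by rewrite [X in (_ + X)%E]mu_pt adde0.
- by apply/seteqP; split => // x [] /=; rewrite in_itv/= => /andP[_ +] xb; rewrite xb ltxx.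
Qed.

Let mu_cc a b : a <= b -> mu `[a, b]%classic = (F b - F a)%:E.
Proof.
move=> ab; rewrite -(mu_oc ab) -(@setU1itv _ _ (BRight b) a false)// measureU//.
- by rewrite [X in (X + _)%E]mu_pt add0e.
- by apply/seteqP; split => // x [] /=; rewrite in_itv/= => -> /andP[+ _]; rewrite ltxx.
Qed.

Let mu_Nyo b : mu `]-oo, b[%classic = (F b)%:E.
Proof.
rewrite -FE -(@setUitv1 _ _ -oo%O b true)// measureU//.
- by rewrite [X in (_ + X)%E]mu_pt adde0.
- by apply/seteqP; split => // x [] /=; rewrite in_itv/= => /[swap] ->; rewrite ltxx.
Qed.

Let mu_cy a : mu `[a, +oo[%classic = (1 - F a)%:E.
Proof.
by rewrite -setCitvl probability_setC// mu_Nyo.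
Qed.

Lemma distribution_fun_ndecr (x y : R) : x <= y -> F x <= F y.
Proof.
move=> xy; rewrite -lee_fin -!FE le_measure ?inE//.
by move=> z /=; rewrite !in_itv/= => /le_trans; exact.
Qed.

Lemma measure_unit_itv (A : mset) : measurable A -> mu (`[0, 1]%classic `&` A) = mu A.
Proof.
move=> mA; rewrite [RHS](measureDI mu mA (mi `[0, 1])).
rewrite [X in (X + _)%E](_ : _ = 0%E) ?add0e 1?setIC//.
apply/eqP; rewrite -measure_le0.
have -> : 0%E = mu (~` `[0, 1]%classic) :> \bar R.
  by rewrite probability_setC// mu01 subee.
apply: le_measure; rewrite ?inE; [|exact: measurableC|by move=> x []].
exact: measurableD.
Qed.

Lemma distribution_fun0 (x : R) : x <= 0 -> F x = 0.
Proof.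
move=> x0; apply/eqP; rewrite eq_le -{1}(_ : F 0 = 0); last first.
  apply: EFin_inj; rewrite -FE -measure_unit_itv//.
  rewrite (_ : _ `&` _ = [set 0]) ?mu_pt//.
  apply/seteqP; split=> z /=; rewrite !in_itv/=; first by move=> [/andP[a _] b]; lra.
  by move=> ->; rewrite lexx ler01.
by rewrite distribution_fun_ndecr// -lee_fin -FE measure_ge0.
Qed.

Lemma distribution_fun1 (x : R) : 1 <= x -> F x = 1.
Proof.
move=> x1; apply: EFin_inj; rewrite -FE -measure_unit_itv//.
rewrite (_ : _ `&` _ = `[0, 1]%classic) ?mu01//.
apply/seteqP; split=> z /=; rewrite !in_itv/=; first by case.
by move=> /andP[-> z1]; rewrite z1 (le_trans z1).
Qed.

Section invariance.
Variable f : R -> R.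
Hypothesis mu_inv : forall A : mset, measurable A -> A `<=` `[0, 1]%classic ->
  mu (`[0, 1]%classic `&` f @^-1` A) = mu A.
Hypothesis f01 : forall x : R, x \in `[0, 1] -> f x \in `[0, 1].

(** Invariance applied to the half-line up to [x], cut down to [[0, 1]] because it is assumed only
    for subsets of that interval. Accordingly [B] has to match the preimage only inside [[0, 1]]. *)
Let F_preimage (x : R) (B : mset) : measurable B ->
  (forall y : R, y \in `[0, 1] -> f y <= x <-> B y) -> (F x)%:E = mu B.
Proof.
move=> mB BP; rewrite -FE -(measure_unit_itv (mi _)) -(measure_unit_itv mB).
rewrite -mu_inv; last 2 first.
- exact: measurableI.
- by move=> y [].
congr (mu _); apply/seteqP; split=> y [/= y01].
  by rewrite !in_itv/= => -[_ fx]; split => //; apply/BP.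
move=> By; split => //; rewrite !in_itv/=; split; first exact: (f01 y01).
by apply/BP.
Qed.

(** When [f] has a maximum at the critical point, its sublevel sets consist of two outer pieces;
    [distribution_fun_min] treats a minimum, where they are intervals. *)
Lemma distribution_fun_max (x y1 y2 : R) : y1 < y2 ->
  (forall y : R, y \in `[0, 1] -> f y <= x <-> (y <= y1) || (y2 <= y)) ->
  F x = F y1 + 1 - F y2.
Proof.
move=> y12 P; apply: EFin_inj.
rewrite (F_preimage (B := `]-oo, y1]%classic `|` `[y2, +oo[%classic)).
- rewrite measureU//; last first.
    by apply/seteqP; split=> // y [] /=; rewrite !in_itv/= andbT => a b; lra.
  by have /= -> := FE y1; have /= -> := mu_cy y2; rewrite -EFinD addrA.
- exact: measurableU.
- move=> y y01; rewrite P//=; rewrite !in_itv/= andbT; by split=> /orP.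
Qed.

Lemma distribution_fun_min (x y1 y2 : R) : y1 <= y2 ->
  (forall y : R, y \in `[0, 1] -> f y <= x <-> y1 <= y <= y2) -> F x = F y2 - F y1.
Proof.
move=> y12 P; apply: EFin_inj; rewrite (F_preimage (B := `[y1, y2]%classic))//.
exact: mu_cc.
Qed.

Lemma distribution_fun_top (x : R) :
  (forall y : R, y \in `[0, 1] -> f y <= x) -> F x = 1.
Proof.
move=> P; apply: EFin_inj; rewrite (F_preimage (B := setT))//.
  exact: probability_setT.
by move=> y /P.
Qed.

End invariance.

Section density.
Hypothesis rho_mf : measurable_fun setT (rho : measurableTypeR R -> R).
Hypothesis rho_int : forall A : mset, measurable A ->
  mu A = (\int[@lebesgue_measure R]_(x in A) (rho x)%:E)%E.

Lemma distribution_fun_slope (a b al ga : R) : a < b ->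
  (forall y, a < y -> y < b -> al <= rho y <= ga) ->
  al * (b - a) <= F b - F a <= ga * (b - a).
Proof.
move=> ab bnd.
have mab : measurable (`]a, b[%classic : set (measurableTypeR R)) by [].
have leb : (@lebesgue_measure R) `]a, b[%classic = (b - a)%:E.
  by rewrite lebesgue_measure_itv/= lte_fin ab.
have fin : ((@lebesgue_measure R) `]a, b[%classic < +oo)%E by rewrite leb ltry.
have icst r : (@lebesgue_measure R).-integrable `]a, b[%classic (EFin \o cst r).
  by apply: measurable_bounded_integrable => //; exact: bounded_cst.
have irho : (@lebesgue_measure R).-integrable `]a, b[%classic (EFin \o rho).
  apply: measurable_bounded_integrable => //; first exact: measurable_funS rho_mf.
  exists (`|al| + `|ga|); split; first exact: num_real.
  move=> M lM y /=; rewrite in_itv/= => /andP[ay yb]; apply: le_trans (ltW lM).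
  have /andP[h1 h2] := bnd y ay yb; rewrite ler_norml.
  have := ler_norm ga; have := ler_norm (- al); rewrite normrN.
  have := normr_ge0 al; have := normr_ge0 ga; lra.
have cstE r : (\int[@lebesgue_measure R]_(x in `]a, b[%classic) (EFin \o cst r) x)%E =
    (r * (b - a))%:E.
  rewrite EFinM -leb.
  exact: (@integral_cst _ _ _ (@lebesgue_measure R) _ mab r%:E).
rewrite -!lee_fin -cstE -(cstE ga) -mu_oc ?(ltW ab)// -mu_oo rho_int//.
by rewrite !le_integral//= => y; rewrite inE/= in_itv/= => /andP[ay yb];
  rewrite lee_fin; case/andP: (bnd y ay yb).
Qed.

End density.

End distribution_function.

(** * Reflection in the origin, and mean value estimates *)

Section opposite_filters.
Context {R : realType}.
Implicit Types y : R.

Lemma cvg_opp_dnbhs y : - z @[z --> y^'] --> (- y)^'.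
Proof.
move=> A /nbhs_ballP[e /= e0 eA]; apply/nbhs_ballP; exists e => //= z.
rewrite /ball/= => yz zy; apply: eA; last by rewrite eqr_opp.
by rewrite /ball/= -opprD normrN.
Qed.

Lemma cvg_opp_at_right y : - z @[z --> y^'+] --> (- y)^'-.
Proof.
apply: cvg_to_at_left.
  by apply: cvgN; exact: cvg_at_right_filter.
by near=> z; rewrite ltrN2; near: z; exact: nbhs_right_gt.
Unshelve. all: by end_near. Qed.

Lemma cvg_opp_at_left y : - z @[z --> y^'-] --> (- y)^'+.
Proof.
apply: cvg_to_at_right.
  by apply: cvgN; exact: cvg_at_left_filter.
by near=> z; rewrite ltrN2; near: z; exact: nbhs_left_lt.
Unshelve. all: by end_near. Qed.

End opposite_filters.

Section everywhere_differentiable.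
Context {R : realType}.
Variables (g D : R -> R).
Hypothesis gD : forall y, diff_quotient g y z @[z --> y^'] --> D y.

Lemma diff_quotient_is_derive (y : R) : is_derive y 1 g (D y).
Proof.
have cv : (fun h : R => h^-1 *: ((g \o shift y) (h *: (1 : R)) - g y)) @ 0^' --> D y.
  apply/cvgrPdist_le => e e0; have /cvgrPdist_le/(_ e e0) := gD (y := y).
  move=> /nbhs_ballP[d /= d0 dP]; apply/nbhs_ballP; exists d => //= k.
  rewrite /ball/= sub0r normrN => kd k0.
  have := dP (k + y); rewrite /ball/= opprD addrCA subrr addr0 normrN => /(_ kd).
  rewrite -subr_eq0 addrK => /(_ k0).
  by rewrite /diff_quotient addrK/= /GRing.scale/= mulr1 mulrC.
have der : derivable g y 1 by apply/cvg_ex; exists (D y).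
by split => //; exact: (cvg_lim (@Rhausdorff R) cv).
Qed.

Lemma diff_quotient_continuous : continuous g.
Proof.
move=> y; apply: differentiable_continuous; apply/derivable1_diffP.
by have [] := diff_quotient_is_derive y.
Qed.

Lemma diff_quotient_MVT u v : u < v ->
  exists z, [/\ u < z, z < v & g v - g u = D z * (v - u)].
Proof.
move=> uv; have [||z zuv ->] := @MVT R g D u v uv.
- by move=> x _; exact: diff_quotient_is_derive.
- by apply: continuous_subspaceT; exact: diff_quotient_continuous.
- by exists z; rewrite !(itvP zuv).
Qed.

Lemma diff_quotient_slope_ge (m u v : R) : u < v ->
  (forall y, u < y -> y < v -> m <= D y) ->
  m * (v - u) <= g v - g u.
Proof.
move=> uv Dm; have [z [uz zv ->]] := diff_quotient_MVT uv.
by rewrite ler_pM2r ?subr_gt0// Dm.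
Qed.

Lemma diff_quotient_slope_le (m u v : R) : u < v ->
  (forall y, u < y -> y < v -> D y <= m) ->
  g v - g u <= m * (v - u).
Proof.
move=> uv Dm; have [z [uz zv ->]] := diff_quotient_MVT uv.
by rewrite ler_pM2r ?subr_gt0// Dm.
Qed.

Lemma diff_quotient_opp y :
  diff_quotient (fun y => - g (- y)) y z @[z --> y^'] --> D (- y).
Proof.
have -> : diff_quotient (fun y => - g (- y)) y = diff_quotient g (- y) \o -%R.
  apply/funext => z; rewrite /diff_quotient/=.
  have -> : - g (- z) - - g (- y) = - (g (- z) - g (- y)) by ring.
  have -> : z - y = - (- z - - y) by ring.
  by rewrite invrN mulrN mulNr opprK.
exact: cvg_comp (@cvg_opp_dnbhs _ y) (gD (y := - y)).
Qed.

End everywhere_differentiable.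

(** * Gluing two global branches into a unimodal map *)

Section branches.
Context {R : realType}.
Implicit Types (F rp rm : R -> R).

Lemma diff_quotient_branches (g1 g2 D1 D2 : R -> R) (c y : R) :
  (forall y, diff_quotient g1 y z @[z --> y^'] --> D1 y) ->
  (forall y, diff_quotient g2 y z @[z --> y^'] --> D2 y) ->
  y != c ->
  diff_quotient (fun y => if y <= c then g1 y else g2 y) y z @[z --> y^'] -->
    (if y <= c then D1 y else D2 y).
Proof.
move=> gD1 gD2; rewrite neq_lt => /orP[] yc.
- rewrite (ltW yc); apply: cvg_trans (gD1 y); apply: near_eq_cvg; near=> z.
  have zc : z < c by near: z; apply: nbhs_dnbhs; exact: lt_nbhsl.
  by rewrite /diff_quotient (ltW yc) (ltW zc).
- rewrite leNgt yc; apply: cvg_trans (gD2 y); apply: near_eq_cvg; near=> z.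
  have zc : c < z by near: z; apply: nbhs_dnbhs; exact: lt_nbhsr.
  by rewrite /diff_quotient !leNgt yc zc.
Unshelve. all: by end_near. Qed.

Lemma unimodal_cdf_of_branches F rp rm (g1 g2 D1 D2 : R -> R) (c lam M V : R) :
  1 < lam ->
  (forall y, diff_quotient g1 y z @[z --> y^'] --> D1 y) ->
  (forall y, diff_quotient g2 y z @[z --> y^'] --> D2 y) ->
  (forall y, lam <= D1 y) -> (forall y, lam <= - D2 y) ->
  (forall y, y < c -> D1 y <= M) -> (forall y, c < y -> - D2 y <= M) ->
  g1 c = g2 c ->
  (forall y1 y2, y1 < c -> c < y2 -> g1 y1 = g2 y2 ->
     F (g1 y1) = F y1 + 1 - F y2) ->
  (forall x, g1 c <= x -> F x = 1) -> bv_cdf F rp rm V ->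
  unimodal_cdf F (fun y => if y <= c then g1 y else g2 y)
    (fun y => if y <= c then D1 y else D2 y) rp rm c lam M V.
Proof.
move=> lam1 gD1 gD2 D1l D2l D1M D2M gc Feq Ftop hF.
have lam0 : 0 < lam by exact: lt_trans lam1.
pose f y := if y <= c then g1 y else g2 y.
have f1 y : y <= c -> f y = g1 y by rewrite /f => ->.
have f2 y : c <= y -> f y = g2 y.
  by rewrite /f le_eqVlt => /orP[/eqP <-|cy]; rewrite ?lexx// leNgt cy.
have inc y z : y < z -> lam * (z - y) <= g1 z - g1 y.
  by move=> yz; apply: (diff_quotient_slope_ge gD1 yz).
have dec y z : y < z -> lam * (z - y) <= g2 y - g2 z.
  move=> yz; have := diff_quotient_slope_le gD2 yz (m := - lam).
  rewrite mulNr -[X in X <= _]opprB lerN2; apply => w _ _.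
  by rewrite lerNr.
split => //.
- move=> y z yz zc; rewrite -/(f y) -/(f z) !f1 ?(le_trans (ltW yz))// inc//=.
  apply: (diff_quotient_slope_le gD1 yz) => w _ wz; apply: D1M.
  exact: lt_le_trans zc.
- move=> y z cy yz; rewrite -/(f y) -/(f z) !f2 ?(le_trans cy (ltW yz))// dec//=.
  have := diff_quotient_slope_ge gD2 yz (m := - M).
  rewrite mulNr -[X in _ <= X]opprB lerN2; apply => w yw _.
  by rewrite lerNl D2M// (le_lt_trans cy).
- move=> x; rewrite -/(f c) f1// => xc.
  (* The slope is at least [lam > 1], so moving left from [c] by the height to be lost, [g1 c - x],
     is enough to bring [g1] down to [x]. *)
  pose a := c - (g1 c - x); have ac : a < c by rewrite /a; lra.
  have g1a : g1 a <= x.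
    have := inc _ _ ac; rewrite /a opprB addrCA subrr addr0 => le.
    have : g1 c - x <= lam * (g1 c - x) by rewrite ler_peMl ?ltW// subr_gt0.
    lra.
  have [||y yi gy] := @IVT R g1 a c x (ltW ac).
  + by apply: continuous_subspaceT; exact: diff_quotient_continuous gD1.
  + by rewrite ge_min le_max g1a (ltW xc) orbT.
  have yc : y < c.
    rewrite lt_neqAle (itvP yi) andbT; apply/eqP => yc.
    by move: xc; rewrite -gy yc ltxx.
  by exists y => //; rewrite -/(f y) f1// ltW.
- move=> x; rewrite -/(f c) f2// => xc.
  pose a := c + (g2 c - x); have ac : c < a by rewrite /a; lra.
  have g1a : g2 a <= x.
    have := dec _ _ ac; rewrite /a addrAC subrr add0r => le.
    have : g2 c - x <= lam * (g2 c - x) by rewrite ler_peMl ?ltW// subr_gt0.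
    lra.
  have [||y yi gy] := @IVT R g2 c a x (ltW ac).
  + by apply: continuous_subspaceT; exact: diff_quotient_continuous gD2.
  + by rewrite ge_min le_max g1a (ltW xc) orbT.
  have yc : c < y.
    rewrite lt_neqAle (itvP yi) andbT; apply/eqP => yc.
    by move: xc; rewrite -gy yc ltxx.
  by exists y => //; rewrite -/(f y) f2// ltW.
- by move=> y yc; exact: diff_quotient_branches.
- move=> y1 y2 y1c cy2; rewrite -/(f y1) -/(f y2) f1 ?f2 ?ltW//.
  exact: Feq.
- by move=> x; rewrite -/(f c) f1//; exact: Ftop.
Qed.

(** [1 - F (- x)] is the distribution function of the measure reflected in the origin, which has no
    atoms. Reflection exchanges left and right limits. *)
Lemma bv_cdf_opp F rp rm V : bv_cdf F rp rm V ->
  bv_cdf (fun x => 1 - F (- x)) (rm \o -%R) (rp \o -%R) V.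
Proof.
move=> hF.
have dqE x : diff_quotient (fun x => 1 - F (- x)) x = diff_quotient F (- x) \o -%R.
  apply/funext => z; rewrite /diff_quotient/=.
  have -> : 1 - F (- z) - (1 - F (- x)) = - (F (- z) - F (- x)) by ring.
  have -> : z - x = - (- z - - x) by ring.
  by rewrite invrN mulrN mulNr opprK.
split.
- by move=> x y xy; rewrite lerD2l lerN2 (cdf_nd hF)// lerN2.
- have [l [u [Fl Fu]]] := cdf_supp hF; exists (- u), (- l); split=> x lx.
    by rewrite Fu ?subrr// lerNr.
  by rewrite Fl ?subr0// lerNl.
- move=> x; rewrite dqE; exact: cvg_comp (@cvg_opp_at_right _ x) (cdf_rm hF (x := - x)).
- move=> x; rewrite dqE; exact: cvg_comp (@cvg_opp_at_left _ x) (cdf_rp hF (x := - x)).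
- move=> s us; have := cdf_jump hF (s := map -%R s).
  rewrite (map_inj_uniq oppr_inj) => /(_ us).
  by rewrite big_map; under eq_bigr do rewrite distrC.
- have [a [b [al [ab al0 sl]]]] := cdf_pos hF; exists (- b), (- a), al.
  split; rewrite ?ltrN2// => u v bu uv va.
  have := sl (- v) (- u); rewrite lerNr => /(_ va).
  rewrite ltrN2 lerNl => /(_ uv bu); lra.
Qed.

End branches.

(** * Derivatives within an interval and affine extension *)

Section derivatives_within.
Context {R : realType}.
Implicit Types (g : R -> R) (p q x : R).

Lemma within_dnbhs_itv_proper p q x : p < q -> x \in `[p, q] ->
  ProperFilter (within `[p, q]%classic x^').
Proof.
move=> pq; rewrite in_itv/= => /andP[px xq].
apply: Build_ProperFilter_ex => P; rewrite /within/= => /nbhs_ballP[e /= e0 eP].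
have [xltq|qx] := ltP x q.
  pose z := Num.min q (x + e / 2).
  have e2 : 0 < e / 2 by rewrite divr_gt0.
  have xz : x < z by rewrite lt_min xltq ltrDl.
  have zx : z <= x + e / 2 by rewrite ge_min lexx orbT.
  exists z; apply: eP.
  - by rewrite /ball/= ltr0_norm ?subr_lt0//; lra.
  - by rewrite gt_eqF.
  - by rewrite in_itv/= ge_min lexx (le_trans px (ltW xz)).
pose z := Num.max p (x - e / 2).
have e2 : 0 < e / 2 by rewrite divr_gt0.
have xz : z < x by rewrite gt_max (lt_le_trans pq)//= ltrBlDr ltrDl.
have zx : x - e / 2 <= z by rewrite le_max lexx orbT.
exists z; apply: eP.
- by rewrite /ball/= gtr0_norm ?subr_gt0//; lra.
- by rewrite lt_eqF.
- by rewrite in_itv/= le_max lexx (le_trans (ltW xz) xq).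
Qed.

Lemma derive_within_itvE p q g x l : p < q -> x \in `[p, q] ->
  diff_quotient g x z @[z --> within `[p, q]%classic x^'] --> l ->
  derive_within `[p, q]%classic g x = l.
Proof.
move=> pq xi; have := within_dnbhs_itv_proper pq xi => PF.
by apply: cvg_lim; exact: Rhausdorff.
Qed.

Lemma derivable_within_continuous (A : set R) g :
  (forall x, A x -> derivable_within A g x) -> {within A, continuous g}.
Proof.
move=> der; apply/subspace_continuousP => x Ax.
have /cvg_ex[/= l /cvgrPdist_le/(_ 1 ltr01)] := der _ Ax.
rewrite near_withinE => nx.
apply/cvgrPdist_le => e e0; rewrite near_withinE.
have k0 : 0 < `|l| + 1 by rewrite ltr_wpDl.
move: nx; rewrite /dnbhs near_withinE => nx.
near=> z => Az; have [->|zx] := eqVneq z x; first by rewrite subrr normr0 ltW.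
have lz : `|l - diff_quotient g x z| <= 1.
  have H : z != x -> A z -> `|l - diff_quotient g x z| <= 1 by near: z.
  exact: H.
have dz : `|z - x| <= e / (`|l| + 1).
  rewrite distrC; near: z; apply: cvgr_dist_le; first exact: cvg_id.
  by rewrite divr_gt0.
have -> : g x - g z = - (diff_quotient g x z * (z - x)).
  by rewrite /diff_quotient divfK ?subr_eq0// opprB.
rewrite normrN normrM.
have dl : `|diff_quotient g x z| <= `|l| + 1.
  have := ler_normB l (l - diff_quotient g x z).
  have -> : l - (l - diff_quotient g x z) = diff_quotient g x z by ring.
  by move=> /le_trans; apply; rewrite lerD2l.
have := ler_pM (normr_ge0 _) (normr_ge0 _) dl dz.
by rewrite mulrCA mulfV ?mulr1// gt_eqF.
Unshelve. all: by end_near. Qed.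

(* A branch is extended affinely to the whole line, so that boundary points of
   its domain need no special treatment. *)
Lemma C2_affine_extension p q g lam : p < q -> 0 < lam ->
  C2_on `[p, q]%classic g ->
  (forall x, x \in `[p, q] -> lam <= `|derive_within `[p, q]%classic g x|) ->
  exists ge Dg : R -> R, exists B, [/\ forall x, x \in `[p, q] -> ge x = g x,
    forall y, diff_quotient ge y z @[z --> y^'] --> Dg y,
    (forall y, y <= p -> Dg y = Dg p) /\ (forall y, q <= y -> Dg y = Dg q),
    forall y, `|Dg y| <= B &
    (forall y, lam <= Dg y) \/ (forall y, lam <= - Dg y)].
Proof.
move=> pq lam0 [der1 der2 _] lamD.
pose d := derive_within `[p, q]%classic g.
have dc : {within `[p, q], continuous d} by exact: derivable_within_continuous.
have pi : p \in `[p, q] by rewrite in_itv/= lexx ltW.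
have qi : q \in `[p, q] by rewrite in_itv/= lexx ltW.
(* [cl] projects the line onto [[p, q]]. The extension will have derivative [d (cl y)] at [y], so
   bounds and sign are inherited from the interval. *)
pose cl (y : R) := Num.max p (Num.min q y).
have clp y : y <= p -> cl y = p.
  by move=> yp; rewrite /cl min_r ?max_l// (le_trans yp) ?ltW.
have clq y : q <= y -> cl y = q.
  by move=> qy; rewrite /cl min_l// max_r// ltW.
have cli y : p <= y -> y <= q -> cl y = y.
  by move=> py yq; rewrite /cl min_r// max_r.
have clin y : cl y \in `[p, q].
  by rewrite in_itv/= /cl le_max lexx/= ge_max ge_min lexx (ltW pq).
pose ge y := if y < p then g p + d p * (y - p) else
             if y <= q then g y else g q + d q * (y - q).
have gei x : p <= x -> x <= q -> ge x = g x.
  by move=> px xq; rewrite /ge ltNge px xq.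
have gel x : x <= p -> ge x = g p + d p * (x - p).
  rewrite le_eqVlt /ge => /orP[/eqP ->|->//].
  by rewrite ltxx (ltW pq) subrr mulr0 addr0.
have ger x : q <= x -> ge x = g q + d q * (x - q).
  rewrite le_eqVlt /ge => /orP[/eqP <-|qx].
    by rewrite ltNge (ltW pq) lexx subrr mulr0 addr0.
  by rewrite ltNge (le_trans (ltW pq) (ltW qx))/= leNgt qx.
have dqa (a b x z : R) : z != x ->
      ((a + d b * (z - b)) - (a + d b * (x - b))) / (z - x) = d b.
  move=> zx; apply: (mulIf (x := z - x)); first by rewrite subr_eq0.
  by rewrite divfK ?subr_eq0//; ring.
have ge_der y : diff_quotient ge y z @[z --> y^'] --> d (cl y).
  apply/cvgrPdist_le => e e0.
  (* Inside the interval the quotient is that of [g]. At an endpoint, the outer side has constant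
     slope equal to the one-sided derivative, so the two sides agree. *)
  have nin : p <= y -> y <= q -> \forall z \near y^', p <= z -> z <= q ->
      `|d y - diff_quotient ge y z| <= e.
    move=> py yq; have yi : y \in `[p, q] by rewrite in_itv/= py.
    have := der1 y yi; rewrite /derivable_within => cv.
    have /cvgrPdist_le/(_ e e0) :
        diff_quotient g y z @[z --> within `[p, q]%classic y^'] --> d y.
      exact: cv.
    rewrite near_withinE; apply: filterS => z H pz zq.
    rewrite /diff_quotient !gei//; apply: H => /=; by rewrite in_itv/= pz.
  have nlt a : \forall z \near y^', y < a -> z < a.
    have [ya|ay] := ltP y a; last by apply: filterE => z; lra.
    by apply: nbhs_dnbhs; apply: filterS (lt_nbhsl ya) => z.
  have ngt a : \forall z \near y^', a < y -> a < z.
    have [ya|ay] := ltP a y; last by apply: filterE => z; lra.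
    by apply: nbhs_dnbhs; apply: filterS (lt_nbhsr ya) => z.
  near=> z; have zy : z != y by near: z; exact: nbhs_dnbhs_neq.
  have zlt a : a \in [:: p; q] -> y < a -> z < a.
    by rewrite !inE => /orP[] /eqP ->; near: z; exact: nlt.
  have zgt a : a \in [:: p; q] -> a < y -> a < z.
    by rewrite !inE => /orP[] /eqP ->; near: z; exact: ngt.
  have nin' : p <= y -> y <= q -> p <= z -> z <= q ->
      `|d y - diff_quotient ge y z| <= e.
    near: z; have [py|yp] := leP p y; last by apply: filterE.
    have [yq|qy] := leP y q; last by apply: filterE.
    by apply: filterS (nin py yq) => z zn _ _.
  have [yp|py] := ltP y p.
    have zp : z < p by apply: zlt => //; rewrite !inE eqxx.
    by rewrite clp ?(ltW yp)// /diff_quotient !gel ?(ltW yp) ?(ltW zp)// dqa// subrr normr0 ltW.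
  have [qy|yq] := ltP q y.
    have zp : q < z by apply: zgt => //; rewrite !inE eqxx orbT.
    by rewrite clq ?(ltW qy)// /diff_quotient !ger ?(ltW qy) ?(ltW zp)// dqa// subrr normr0 ltW.
  rewrite cli//; have [zp|pz] := ltP z p.
    have py' : y = p.
      move: py; rewrite le_eqVlt => /orP[/eqP//|py].
      have : p < z by apply: zgt => //; rewrite !inE eqxx.
      lra.
    have yp : y <= p by rewrite py'.
    by rewrite /diff_quotient !gel ?(ltW zp)// dqa// py' subrr normr0 ltW.
  have [qz|zq] := ltP q z.
    have yq' : y = q.
      move: yq; rewrite le_eqVlt => /orP[/eqP//|yq].
      have : z < q by apply: zlt => //; rewrite !inE eqxx orbT.
      lra.
    have qy : q <= y by rewrite yq'.
    by rewrite /diff_quotient !ger ?(ltW qz)// dqa// yq' subrr normr0 ltW.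
  exact: nin'.
have [xM xMi dM] := EVT_max (ltW pq) dc.
have [xm xmi dm] := EVT_min (ltW pq) dc.
exists ge, (d \o cl), (`|d xM| + `|d xm|); split.
- by move=> x; rewrite in_itv/= => /andP[px xq]; exact: gei.
- exact: ge_der.
- split=> y yp /=; first by rewrite (clp _ yp) (clp _ (lexx p)).
  by rewrite (clq _ yp) (clq _ (lexx q)).
- move=> y /=; have := dM _ (clin y); have := dm _ (clin y).
  rewrite ler_norml; have := ler_norm (d xM); have := ler_norm (- d xm).
  rewrite normrN; have := normr_ge0 (d xM); have := normr_ge0 (d xm); lra.
(* [d] is continuous, because [g] is twice differentiable, and stays at distance at least [lam] from
   0; by the intermediate value theorem it has constant sign. *)
- have sgn x y : x \in `[p, q] -> y \in `[p, q] -> d x < 0 -> 0 < d y -> False.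
    have ivt u v : u \in `[p, q] -> v \in `[p, q] -> u <= v ->
        Num.min (d u) (d v) <= 0 <= Num.max (d u) (d v) -> False.
      move=> ui vi uv mm; have [|w wi dw] := @IVT R d u v 0 uv _ mm.
        apply: continuous_subspaceW dc => z /=; rewrite !in_itv/= => /andP[uz zv].
        by rewrite (le_trans _ uz) ?(le_trans zv) ?(itvP ui) ?(itvP vi).
      have wi' : w \in `[p, q].
        rewrite in_itv/= (@le_trans _ _ u) ?(itvP ui) ?(itvP wi)//.
        by rewrite (@le_trans _ _ v) ?(itvP vi) ?(itvP wi).
      by have := lamD _ wi'; rewrite -/(d w) dw normr0 leNgt lam0.
    move=> xi yi dx dy; have [xy|yx] := leP x y.
      by apply: (ivt x y) => //; rewrite ge_min le_max (ltW dx) (ltW dy) orbT.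
    by apply: (ivt y x) => //; rewrite ?(ltW yx)// ge_min le_max (ltW dx) (ltW dy) orbT.
  have [dp|dp] := leP 0 (d p).
    left=> y /=; have := lamD _ (clin y); rewrite -/(d _).
    have [dy|dy] := leP 0 (d (cl y)); first by rewrite ger0_norm.
    exfalso; apply: (sgn _ _ (clin y) pi dy).
    rewrite lt_neqAle dp andbT; apply/eqP => dp0.
    by have := lamD _ pi; rewrite -/(d p) -dp0 normr0 leNgt lam0.
  right=> y /=; have := lamD _ (clin y); rewrite -/(d _).
  have [dy|dy] := ltP 0 (d (cl y)); last by rewrite ler0_norm.
  by exfalso; exact: (sgn _ _ pi (clin y) dp dy).
Unshelve. all: by end_near. Qed.

End derivatives_within.

(** * Differentiability bounds nearby jumps *)

Section pointwise_lipschitz.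
Context {R : realType}.
Implicit Types (rho : R -> R) (x K d p r : R).

Lemma derivable_pointwise_lipschitz rho x : derivable rho x 1 ->
  exists K d, 0 < d /\ forall y, `|y - x| < d -> `|rho y - rho x| <= K * `|y - x|.
Proof.
move=> /cvg_ex[/= l /cvgrPdist_le/(_ 1 ltr01)/nbhs_ballP[d /= d0 dP]].
exists (`|l| + 1), d; split => // y yd.
have [->|yx] := eqVneq y x; first by rewrite !subrr !normr0 mulr0.
have := dP (y - x); rewrite /ball/= sub0r normrN => /(_ yd).
rewrite subr_eq0 => /(_ yx); rewrite /GRing.scale/= mulr1 subrK => lq.
have -> : rho y - rho x = (y - x)^-1 * (rho y - rho x) * (y - x).
  by rewrite mulrAC mulVf ?mul1r// subr_eq0.
rewrite normrM ler_wpM2r//.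
have := ler_normB l (l - (y - x)^-1 * (rho y - rho x)).
have -> : l - (l - (y - x)^-1 * (rho y - rho x)) = (y - x)^-1 * (rho y - rho x) by ring.
by move=> /le_trans; apply; rewrite lerD2l.
Qed.

Lemma pointwise_lipschitz_limit rho x K d (S : set_system R) {FS : ProperFilter S} p r :
  (forall y, `|y - x| < d -> `|rho y - rho x| <= K * `|y - x|) ->
  `|p - x| < d -> z @[z --> S] --> p -> rho z @[z --> S] --> r ->
  `|r - rho x| <= K * `|p - x|.
Proof.
move=> lip pd Sp Sr; rewrite -subr_le0.
have cv : (`|rho z - rho x| - K * `|z - x|) @[z --> S] --> `|r - rho x| - K * `|p - x|.
  apply: cvgB; first by apply: cvg_norm; apply: cvgB => //; exact: cvg_cst.
  by apply: cvgMr; apply: cvg_norm; apply: cvgB => //; exact: cvg_cst.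
rewrite -(cvg_lim (@Rhausdorff R) cv); apply: limr_le.
  by apply/cvg_ex; eexists; exact: cv.
have : `|z - x| @[z --> S] --> `|p - x|.
  by apply: cvg_norm; apply: cvgB => //; exact: cvg_cst.
move=> /cvgr_lt/(_ _ pd); apply: filterS => z /lip.
by rewrite subr_le0.
Qed.

(** Both one-sided limits at [p] are within [K * |p - x|] of [rho x], whence the factor 2. The value
    of [rho] at [p] does not enter. *)
Lemma pointwise_lipschitz_jump rho x K d (rp rm : R -> R) :
  (forall y, rho z @[z --> y^'+] --> rp y) ->
  (forall y, rho z @[z --> y^'-] --> rm y) ->
  (forall y, `|y - x| < d -> `|rho y - rho x| <= K * `|y - x|) ->
  forall p, `|p - x| < d -> `|rp p - rm p| <= 2 * K * `|p - x|.
Proof.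
move=> rpP rmP lip p pd.
have Sr : z @[z --> p^'+] --> p by exact: cvg_at_right_filter.
have Sl : z @[z --> p^'-] --> p by exact: cvg_at_left_filter.
have := pointwise_lipschitz_limit lip pd Sr (rpP p).
have := pointwise_lipschitz_limit lip pd Sl (rmP p).
move=> /(_ _) h1 /(_ _) h2.
have -> : rp p - rm p = (rp p - rho x) - (rm p - rho x) by ring.
by apply: le_trans (ler_normB _ _) _; lra.
Qed.

End pointwise_lipschitz.

(** * From the density and the map to the abstract setting *)

Section density_cdf.
Context {R : realType}.

Lemma bv_density_cdf (mu : probability (measurableTypeR R) R) (rho : R -> R) :
  mu `[0, 1]%classic = 1%E -> mu `<< (@lebesgue_measure R) -> bv_density mu rho ->
  exists rp rm V, [/\ forall x, rho y @[y --> x^'+] --> rp x,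
    forall x, rho y @[y --> x^'-] --> rm x & bv_cdf (distribution_fun mu) rp rm V].
Proof.
move=> mu01 ac [rho_mf rho_int bv rho0].
have [rp [rm [V [rpP rmP rhoV Vsum]]]] := bv_zero_extension_jumps bv rho0.
have slope := distribution_fun_slope ac rho_mf rho_int.
exists rp, rm, V; split => //.
have F0 := distribution_fun0 mu01 ac; have F1 := distribution_fun1 mu01.
have V0 : 0 <= V by exact: le_trans (rhoV 0).
(* A density bounded by [V] makes [F] Lipschitz, which supplies the continuity that
   [slope_pos_interval] asks for. *)
have Flip x y : x < y ->
    `|distribution_fun mu y - distribution_fun mu x| <= V * (y - x).
  move=> xy; have bnd z : x < z -> z < y -> - V <= rho z <= V.
    by move=> _ _; rewrite -ler_norml.
  by rewrite ler_norml -mulNr; exact: slope.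
have Flip' x y : `|distribution_fun mu x - distribution_fun mu y| <= V * `|x - y|.
  have [xy|yx|->] := ltgtP x y; last by rewrite !subrr !normr0 mulr0.
  - by rewrite distrC (distrC x) (gtr0_norm (x := y - x)) ?subr_gt0// Flip.
  - by rewrite (gtr0_norm (x := x - y)) ?subr_gt0// Flip.
split => //.
- exact: distribution_fun_ndecr.
- by exists 0, 1.
- by move=> x; exact: (diff_quotient_right slope (rpP x)).
- by move=> x; exact: (diff_quotient_left slope (rmP x)).
- apply: (slope_pos_interval slope (rp := rp) (a := 0) (b := 1)) => //.
    by rewrite F0// F1// ltr01.
  apply: continuous_subspaceT => x; apply/cvgrPdist_le => e e0.
  have V1 : 0 < V + 1 by rewrite ltr_wpDl.
  near=> z; apply: le_trans (Flip' x z) _.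
  have dz : `|x - z| <= e / (V + 1).
    by near: z; apply: cvgr_dist_le; [exact: cvg_id|rewrite divr_gt0].
  apply: (@le_trans _ _ ((V + 1) * `|x - z|)); first by rewrite ler_wpM2r// lerDl.
  by rewrite mulrC -ler_pdivlMr.
Unshelve. all: by end_near. Qed.

End density_cdf.

Section peum_branches.
Context {R : realType}.
Implicit Types (f : R -> R) (c : R).

Lemma peum_branches f c : peum f c -> exists lam (g1 g2 D1 D2 : R -> R),
  [/\ 1 < lam,
      (forall y, diff_quotient g1 y z @[z --> y^'] --> D1 y) /\
      (forall y, diff_quotient g2 y z @[z --> y^'] --> D2 y),
      g1 c = g2 c /\ (forall x, x \in `[0, 1] -> f x = if x <= c then g1 x else g2 x),
      (forall y, y < c -> `|D1 y| <= max_abs_derive f c) /\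
      (forall y, c < y -> `|D2 y| <= max_abs_derive f c) &
      (forall y, lam <= D1 y) /\ (forall y, lam <= - D2 y) \/
      (forall y, lam <= - D1 y) /\ (forall y, lam <= D2 y)].
Proof.
move=> [f01 c01 [e [lam [f1 [f2 [[e0 lam1] [ff1 ff2] f12 [C1 D1l] [C2 D2l]]]]]]].
have /andP[c0 c1] : 0 <= c <= 1 by move: c01; rewrite in_itv.
have lam0 : 0 < lam by exact: lt_trans lam1.
have ce0 : 0 < c + e by rewrite ltr_wpDl.
have ce1 : c - e < 1 by lra.
have [g1 [D1 [B1 [g1E gD1 [D1lo _] D1B D1s]]]] := C2_affine_extension ce0 lam0 C1 D1l.
have [g2 [D2 [B2 [g2E gD2 [_ D2hi] D2B D2s]]]] := C2_affine_extension ce1 lam0 C2 D2l.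
have g12 : g1 c = g2 c by rewrite g1E ?g2E ?in_itv//=; lra.
have fg1 x : 0 <= x -> x <= c -> f x = g1 x.
  by move=> x0 xc; rewrite ff1 ?g1E ?in_itv//=; lra.
have fg2 x : c <= x -> x <= 1 -> f x = g2 x.
  by move=> cx x1; rewrite ff2 ?g2E ?in_itv//=; lra.
have inc (g D : R -> R) u v : (forall y, diff_quotient g y z @[z --> y^'] --> D y) ->
    (forall y, lam <= D y) -> u <= v -> lam * (v - u) <= g v - g u.
  move=> gD Dl; rewrite le_eqVlt => /orP[/eqP->|uv]; first by rewrite !subrr mulr0.
  exact: (diff_quotient_slope_ge gD uv).
have dec (g D : R -> R) u v : (forall y, diff_quotient g y z @[z --> y^'] --> D y) ->
    (forall y, lam <= - D y) -> u <= v -> lam * (v - u) <= g u - g v.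
  move=> gD Dl; rewrite le_eqVlt => /orP[/eqP->|uv]; first by rewrite !subrr mulr0.
  have := diff_quotient_slope_le gD uv (m := - lam).
  rewrite mulNr -[X in X <= _]opprB lerN2; apply => w _ _.
  by rewrite lerNr.
have i0 : (0 : R) \in `[0, 1] by rewrite in_itv/= lexx ler01.
have i1 : (1 : R) \in `[0, 1] by rewrite in_itv/= lexx ler01.
have [/andP[f00 f01'] /andP[f10 f11]] : 0 <= f 0 <= 1 /\ 0 <= f 1 <= 1.
  by move: (f01 _ i0) (f01 _ i1); rewrite !in_itv.
have f0E : f 0 = g1 0 by exact: fg1.
have f1E : f 1 = g2 1 by exact: fg2.
(* If both branches were monotone in the same direction, [f 0] and [f 1] would differ by at least
   [lam > 1], which is impossible in [[0, 1]]. *)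
have signs : (forall y, lam <= D1 y) /\ (forall y, lam <= - D2 y) \/
      (forall y, lam <= - D1 y) /\ (forall y, lam <= D2 y).
  case: D1s D2s => s1 [] s2; [exfalso| by left | by right | exfalso].
    have := inc _ _ _ _ gD1 s1 c0; have := inc _ _ _ _ gD2 s2 c1; lra.
  have := dec _ _ _ _ gD1 s1 c0; have := dec _ _ _ _ gD2 s2 c1; lra.
(* With [c] at an endpoint, a single branch of slope greater than 1 would map [[0, 1]] into itself.
   Both 0 and 1 thus differ from [c], so the slopes of the affine pieces beyond them are among the
   values under the supremum. *)
have cgt0 : 0 < c.
  rewrite lt_neqAle c0 andbT; apply/eqP => cE; move: g12; rewrite -cE => g12.
  case: D2s => s2.
    by have := inc _ _ _ _ gD2 s2 ler01; lra.
  by have := dec _ _ _ _ gD2 s2 ler01; lra.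
have clt1 : c < 1.
  rewrite lt_neqAle c1 andbT; apply/eqP => cE; move: g12; rewrite cE => g12.
  case: D1s => s1.
    by have := inc _ _ _ _ gD1 s1 ler01; lra.
  by have := dec _ _ _ _ gD1 s1 ler01; lra.
have fE x : x \in `[0, 1] -> f x = if x <= c then g1 x else g2 x.
  rewrite in_itv/= => /andP[x0 x1]; have [xc|cx] := leP x c; first exact: fg1.
  by apply: fg2 => //; exact: ltW.
have derE x : x \in `[0, 1] -> x != c ->
    derive_within `[0, 1]%classic f x = if x <= c then D1 x else D2 x.
  move=> xi xc; apply: derive_within_itvE => //.
  have cv := diff_quotient_branches gD1 gD2 xc.
  apply: cvg_trans (@cvg_within_filter _ _ _ _ _ _ `[0, 1]%classic cv).
  apply: near_eq_cvg.
  rewrite near_withinE; apply: filterE => z zi.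
  by rewrite /diff_quotient !fE.
have M1 x : x \in `[0, 1] -> x != c ->
    `|if x <= c then D1 x else D2 x| <= max_abs_derive f c.
  move=> xi xc; rewrite -derE//; apply: ub_le_sup; last first.
    by exists x => //; split => //; apply/eqP.
  (* A bound must be shown, since [sup] dominates the values only for a set bounded above. *)
  exists (B1 + B2) => _ [z [zi zc] <-]; rewrite derE//; last by apply/eqP.
  have := D1B z; have := D2B z; have := normr_ge0 (D1 z); have := normr_ge0 (D2 z).
  by case: ifP => _; lra.
exists lam, g1, g2, D1, D2; split => //; split => y yc.
- have [y0|y0] := leP y 0.
    by have := M1 0 i0; rewrite (D1lo _ y0) lt_eqF// (ltW cgt0); exact.
  have := M1 y; rewrite (ltW yc) lt_eqF// in_itv/= (ltW y0) (ltW (lt_trans yc clt1)).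
  exact.
- have [y1|y1] := leP 1 y.
    by have := M1 1 i1; rewrite (D2hi _ y1) gt_eqF// [1 <= c]leNgt clt1; exact.
  have := M1 y; rewrite [y <= c]leNgt yc gt_eqF// in_itv/= (ltW y1).
  rewrite (ltW (lt_trans cgt0 yc)).
  exact.
Qed.

End peum_branches.

Unset Implicit Arguments.

Theorem lemma4p10 (R : realType) (f : R -> R) (c : R)
    (mu : probability (measurableTypeR R) R) (rho : R -> R) (beta xbar : R)
    (hf : peum f c)
    (hmu : acip f mu)
    (hmix : mixing f mu)
    (hrho : bv_density mu rho)
    (hbeta0 : 0 < beta) (hbeta1 : beta < 1)
    (hbeta : beta * max_abs_derive f c < 1)
    (hxbar : xbar \in Nbeta f c beta) :
  ~ derivable rho xbar 1.
Proof.
move=> /derivable_pointwise_lipschitz[K [d [d0 lip]]].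
have [f01 c01 _] := hf; have [mu01 ac inv] := hmu.
have [rp [rm [V [rpP rmP hF]]]] := bv_density_cdf mu01 ac hrho.
have jlip := pointwise_lipschitz_jump rpP rmP lip.
have [lam [g1 [g2 [D1 [D2 [lam1 [gD1 gD2] [g12 fE] [D1M D2M] signs]]]]]] :=
  peum_branches hf.
have lam0 : 0 < lam by exact: lt_trans lam1.
pose F := distribution_fun mu; set M := max_abs_derive f c in hbeta D1M D2M.
have F_ge0 x : 0 <= F x.
  have := distribution_fun_ndecr mu (x := Num.min x 0) (y := x).
  by rewrite (distribution_fun0 mu01 ac) ?ge_min ?lexx ?orbT//; exact.
(* The extended map agrees with [f] on [[0, 1]], which contains the orbit of [c], so both maps have
   the same critical orbit. *)
pose fe y := if y <= c then g1 y else g2 y.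
have iterE n : iter n fe c = iter n f c /\ iter n f c \in `[0, 1].
  elim: n => [//|n [IH i01]]; rewrite !iterS IH; split; last exact: f01.
  by rewrite (fE _ i01).
have inf : infinite_set [set n | `|iter n fe c - xbar| <= beta ^+ n].
  move: hxbar; rewrite inE => -[_]; apply: contra_not.
  by apply: sub_finite_set => n /=; rewrite (iterE n).1.
case: signs => -[s1 s2].
- have mono1 : {mono g1 : x y / x <= y}.
    apply: le_mono => x y xy; rewrite -subr_gt0.
    apply: lt_le_trans (diff_quotient_slope_ge gD1 xy (m := lam) _) => //.
    by rewrite mulr_gt0// subr_gt0.
  have mono2 : {mono g2 : x y /~ x <= y}.
    apply: le_nmono => x y xy; rewrite -subr_gt0 -opprB oppr_gt0.
    apply: le_lt_trans (diff_quotient_slope_le gD2 xy (m := - lam) _) _.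
      by move=> z _ _; rewrite lerNr.
    by rewrite mulNr oppr_lt0 mulr_gt0// subr_gt0.
  have U : unimodal_cdf F fe (fun y => if y <= c then D1 y else D2 y) rp rm c lam M V.
    apply: unimodal_cdf_of_branches => //.
    + by move=> y /D1M; apply: le_trans; exact: ler_norm.
    + by move=> y /D2M; apply: le_trans; rewrite -normrN; exact: ler_norm.
    + move=> y1 y2 y1c cy2 g12E; apply: (distribution_fun_max mu01 ac inv f01).
        exact: lt_trans cy2.
      move=> y y01; rewrite (fE _ y01); have [yc|cy] := leP y c.
        by rewrite mono1 [y2 <= y]leNgt (le_lt_trans yc cy2) orbF.
      by rewrite g12E mono2 [y <= y1]leNgt (lt_trans y1c cy).
    + move=> x gx; apply: (distribution_fun_top mu01 inv f01) => y y01.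
      apply: le_trans gx; rewrite (fE _ y01); have [yc|cy] := leP y c.
        by rewrite mono1.
      by rewrite g12 mono2 ltW.
  exact: (ucdf_not_lipschitz U hbeta0 hbeta1 hbeta d0 inf jlip).
- have mono1 : {mono g1 : x y /~ x <= y}.
    apply: le_nmono => x y xy; rewrite -subr_gt0 -opprB oppr_gt0.
    apply: le_lt_trans (diff_quotient_slope_le gD1 xy (m := - lam) _) _.
      by move=> z _ _; rewrite lerNr.
    by rewrite mulNr oppr_lt0 mulr_gt0// subr_gt0.
  have mono2 : {mono g2 : x y / x <= y}.
    apply: le_mono => x y xy; rewrite -subr_gt0.
    apply: lt_le_trans (diff_quotient_slope_ge gD2 xy (m := lam) _) => //.
    by rewrite mulr_gt0// subr_gt0.
  (* The inequalities are weak so that [y1 = y2 = c] is allowed: this shows that there is no mass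
     below the minimum value. *)
  have Fmin y1 y2 : y1 <= c -> c <= y2 -> g1 y1 = g2 y2 -> F (g2 y2) = F y2 - F y1.
    move=> y1c cy2 g12E; apply: (distribution_fun_min mu01 ac inv f01).
      exact: le_trans cy2.
    move=> y y01; rewrite (fE _ y01); have [yc|cy] := leP y c.
      by rewrite -g12E mono1 (le_trans yc cy2) andbT.
    by rewrite mono2 (le_trans y1c (ltW cy)).
  (* Conjugating by the reflection turns the minimum at [c] into a maximum at [- c]; the branches
     trade places and keep their derivatives, taken at [- y]. *)
  pose fo y := if y <= - c then - g2 (- y) else - g1 (- y).
  have foE y : fo y = - fe (- y).
    rewrite /fo /fe [- y <= c]lerNl; case: (ltgtP y (- c)) => // ->.
    by rewrite opprK g12.
  have U : unimodal_cdf (fun x => 1 - F (- x)) fo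
      (fun y => if y <= - c then D2 (- y) else D1 (- y))
      (rm \o -%R) (rp \o -%R) (- c) lam M V.
    apply: unimodal_cdf_of_branches => //.
    + by move=> y; exact: diff_quotient_opp.
    + by move=> y; exact: diff_quotient_opp.
    + by move=> y; rewrite ltrNr => /D2M; apply: le_trans; exact: ler_norm.
    + move=> y; rewrite ltrNl => /D1M; apply: le_trans; rewrite -normrN.
      exact: ler_norm.
    + by rewrite opprK g12.
    + move=> y1 y2; rewrite ltrNr ltrNl => cy1 y2c /oppr_inj g12E.
      by rewrite opprK (Fmin (- y2) (- y1)) ?ltW//; lra.
    + move=> x; rewrite opprK lerNl => gx.
      have Fgc : F (g2 c) = 0 by rewrite (Fmin c c)// subrr.
      have F0 : F (- x) <= 0 by rewrite -Fgc; exact: distribution_fun_ndecr.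
      by have := F_ge0 (- x); lra.
    + exact: bv_cdf_opp.
  have iterN n : iter n fo (- c) = - iter n fe c.
    by elim: n => //= n ->; rewrite foE opprK.
  apply: (ucdf_not_lipschitz (xbar := - xbar) U hbeta0 hbeta1 hbeta d0 (K := 2 * K)).
    move: inf; apply: contra_not; apply: sub_finite_set => n /=.
    by rewrite iterN -opprD normrN.
  move=> p; rewrite opprK => px; rewrite /= distrC.
  have -> : `|p + xbar| = `|- p - xbar| by rewrite -opprD normrN.
  by apply: jlip; rewrite -opprD normrN.
Qed.
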